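(* Let $G$ be a simple graph on the vertex set $[n]$. Then $G$ is tame if and only if $G$ is the disjoint union of a complete bipartite graph and some isolated vertices.
   Context: Let $k$ be an algebraically closed field and $R=k[x_1,\ldots,x_n]$. For an ideal $I\subseteq R$, the blowup of $\mathbb{A}^n_k=\mathrm{Spec}(R)$ along $I$ is $\mathrm{Bl}_I(R)=\mathrm{Proj}\big(\bigoplus_{i\ge 0}I^it^i\big)$, and $I$ is called tame if $\mathrm{Bl}_I(R)$ is regular. The edge ideal of a simple graph $G$ on $[n]$ is $I(G)=(x_ix_j : \{i,j\}\text{ is an edge of }G)\subseteq R$, and $G$ is called tame if $I(G)$ is tame. An isolated vertex is a vertex lying on no edge. A complete bipartite graph is a graph whose vertex set is a disjoint union of two sets $V_1,V_2$ (not required to be nonempty) and whose edges are exactly the pairs $\{a,b\}$ with $a\in V_1$, $b\in V_2$. 'Some isolated vertices' may be none. *)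

(* Defs.v *)
From HB Require Import structures.
From mathcomp Require Import all_boot all_algebra.
From mathcomp Require Import ring_quotient fraction.
From mathcomp Require Import boolp.
From mathcomp Require Import mpoly.

Set Implicit Arguments.
Unset Strict Implicit.
Unset Printing Implicit Defensive.

Import GRing.Theory.
Local Open Scope ring_scope.

Local Notation "x %:F" := (FracField.tofrac x).

(* Ideals are predicates on a commutative ring. The library's [idealr_closed]
   and [prime_idealr_closed] are used for proper and prime ideals, and
   [submod_closed] on the regular module [A^o] for ideals which may be the unit
   ideal. *)

Section RegularLocalRings.
Variable A : comNzRingType.

Definition span (X : A -> Prop) (a : A) : Prop :=
  exists s : seq (A * A),
    (forall c, c \in s -> X c.2) /\ a = \sum_(c <- s) c.1 * c.2.

Definition noetherian : Prop :=
  forall J : {pred A}, @submod_closed A A^o J ->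
    exists s : seq A, forall a, a \in J <-> span (fun x => x \in s) a.

Definition prime_ideal (p : {pred A}) : Prop :=
  idealr_closed p /\ prime_idealr_closed p.

Definition maximal_ideal (m : {pred A}) : Prop :=
  idealr_closed m /\
  forall J : {pred A}, idealr_closed J -> {subset m <= J} -> J =i m.

Definition local_with (m : {pred A}) : Prop :=
  maximal_ideal m /\ forall m' : {pred A}, maximal_ideal m' -> m' =i m.

(* p 0 < p 1 < ... < p d *)
Definition prime_chain (d : nat) (p : nat -> {pred A}) : Prop :=
  (forall i, (i <= d)%N -> prime_ideal (p i)) /\
  (forall i, (i < d)%N ->
    {subset p i <= p i.+1} /\ exists2 a, a \in p i.+1 & a \notin p i).

Definition krull_dim (d : nat) : Prop :=
  (exists p, prime_chain d p) /\
  (forall e p, prime_chain e p -> (e <= d)%N).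

Definition regular_local_ring : Prop :=
  noetherian /\
  exists (m : {pred A}) (d : nat),
    [/\ local_with m, krull_dim d &
        exists s : d.-tuple A, forall a, a \in m <-> span (fun x => x \in s) a].

End RegularLocalRings.

(* An N-grading of S, presented by the projections onto the graded pieces. *)
Record grading (S : idomainType) := Grading {
  component : nat -> {additive S -> S};
  component_id : forall d e s,
    component d (component e s) = if d == e then component e s else 0;
  component_sum : forall s, exists N, s = \sum_(d < N) component d s;
  component1 : component 0 1 = 1;
  componentM : forall d e a b,
    component d a = a -> component e b = b -> component (d + e) (a * b) = a * b
}.

Section Proj.
Variables (S : idomainType) (G : grading S).

Definition homogeneous (d : nat) (a : S) : Prop := component G d a = a.

(* The points of Proj S: homogeneous primes not containing the irrelevant
   ideal, which consists of the elements with zero component in degree 0. *)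
Record proj_point := ProjPoint {
  point_pred :> {pred S};
  point_prime : prime_ideal point_pred;
  point_homogeneous : forall d s, s \in point_pred ->
    component G d s \in point_pred;
  point_relevant : exists2 s, component G 0 s = 0 & s \notin point_pred
}.

Variable p : proj_point.

(* The local ring of Proj S at p is the degree 0 part of the localization of S
   at the homogeneous elements outside p. Since S is a domain, it is the ring
   of the fractions a/b of homogeneous elements of the same degree, b not in p,
   inside the fraction field of S. *)
Definition stalk_pred : {pred {fraction S}} := fun x =>
  `[< exists d a b, [/\ homogeneous d a, homogeneous d b, b \notin p &
                       x = a%:F / b%:F] >].

Lemma stalk_subring : subring_closed stalk_pred.
Proof.
have [[p0 p1 _] pM] := point_prime p.
have nz b : b \notin p -> b%:F != 0 :> {fraction S}.
  by apply: contraNneq => /eqP; rewrite tofrac_eq0 => /eqP ->.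
have nM b c : b \notin p -> c \notin p -> b * c \notin p.
  by move=> hb hc; apply/negP => /pM; rewrite (negPf hb) (negPf hc).
split.
- apply/asboolP; exists 0%N, 1, 1; rewrite /homogeneous component1.
  by split=> //; rewrite tofrac1 divr1.
- move=> _ _ /asboolP[d [a [b [ha hb bp ->]]]] /asboolP[e [a' [b' [ha' hb' bp' ->]]]].
  apply/asboolP; exists (d + e)%N, (a * b' - b * a'), (b * b'); split.
  + by rewrite /homogeneous raddfB /= !componentM.
  + exact: componentM.
  + exact: nM.
  + by rewrite -mulNr addf_div ?nz // tofracB !tofracM mulNr [a'%:F * _]mulrC.
- move=> _ _ /asboolP[d [a [b [ha hb bp ->]]]] /asboolP[e [a' [b' [ha' hb' bp' ->]]]].
  apply/asboolP; exists (d + e)%N, (a * a'), (b * b'); split.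
  + exact: componentM.
  + exact: componentM.
  + exact: nM.
  + by rewrite mulf_div !tofracM.
Qed.

HB.instance Definition _ :=
  GRing.isSubringClosed.Build {fraction S} stalk_pred stalk_subring.

Definition stalk := {x : {fraction S} | stalk_pred x}.
HB.instance Definition _ := SubChoice.on stalk.
HB.instance Definition _ := [SubChoice_isSubComNzRing of stalk by <:].

End Proj.

Definition regular_proj (S : idomainType) (G : grading S) : Prop :=
  forall p : proj_point G, regular_local_ring (stalk p).

Section Blowup.
Variable R : idomainType.

(* The powers of the ideal I. For an arbitrary predicate I, [ideal_pow I i] is
   the i-th power of the ideal generated by I. *)
Fixpoint ideal_pow (I : R -> Prop) (i : nat) : R -> Prop :=
  if i is j.+1 then
    span (fun z => exists x y, [/\ I x, ideal_pow I j y & z = x * y])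
  else fun=> True.

Variable I : R -> Prop.

Lemma ideal_pow0 i : ideal_pow I i 0.
Proof. by case: i => //= i; exists [::]; rewrite big_nil. Qed.

Lemma ideal_powD i x y : ideal_pow I i x -> ideal_pow I i y ->
  ideal_pow I i (x + y).
Proof.
case: i => //= i [s [hs ->]] [t [ht ->]]; exists (s ++ t); rewrite big_cat.
by split=> // c; rewrite mem_cat => /orP[/hs|/ht].
Qed.

Lemma ideal_powMl i a x : ideal_pow I i x -> ideal_pow I i (a * x).
Proof.
case: i => //= i [s [hs ->]]; exists [seq (a * c.1, c.2) | c <- s]; split.
  by move=> _ /mapP[c /hs ? ->].
by rewrite big_map mulr_sumr; apply: eq_bigr => c _; rewrite mulrA.
Qed.

Lemma ideal_powM i j x y : ideal_pow I i x -> ideal_pow I j y ->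
  ideal_pow I (i + j) (x * y).
Proof.
elim: i x => [|i IHi] x; first by move=> _; apply: ideal_powMl.
rewrite addSn => -[s [hs ->]] hy.
exists [seq (c.1, c.2 * y) | c <- s]; split; last first.
  by rewrite big_map mulr_suml; apply: eq_bigr => c _; rewrite mulrA.
move=> _ /mapP[c /hs [u [v [hu hv ->]]] ->] /=.
by exists u, (v * y); split; rewrite ?mulrA //; apply: IHi.
Qed.

(* The Rees algebra, the subring of R[t] of the sums of the a_i t^i with a_i in
   the i-th power of I. *)
Definition rees_pred : {pred {poly R}} := fun p =>
  `[< forall i, ideal_pow I i p`_i >].

Lemma rees_divring : divring_closed rees_pred.
Proof.
have hC c : c%:P \in rees_pred.
  by apply/asboolP => -[|i] //; rewrite coefC; apply: ideal_pow0.
have hB u v : u \in rees_pred -> v \in rees_pred -> u - v \in rees_pred.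
  move=> /asboolP hu /asboolP hv; apply/asboolP => i.
  by rewrite coefB -mulN1r; apply: ideal_powD => //; apply: ideal_powMl.
have hM u v : u \in rees_pred -> v \in rees_pred -> u * v \in rees_pred.
  move=> /asboolP hu /asboolP hv; apply/asboolP => i; rewrite coefM.
  elim/big_ind: _ => [|x y|j _]; [exact: ideal_pow0 | exact: ideal_powD |].
  by rewrite -{1}(subnKC (ltnSE (ltn_ord j))); apply: ideal_powM.
split=> [|//|u v hu hv]; first exact: (hC 1).
apply: hM => //; have [uv|/invr_out -> //] := boolP (v \is a GRing.unit).
have [i] : exists i, v^-1 = i%:P; last by move=> ->; apply: hC.
have: v^-1 \is a GRing.unit by rewrite unitrV.
by rewrite poly_unitE => /andP[/size_poly1P[c _ ->] _]; exists c.
Qed.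

HB.instance Definition _ :=
  GRing.isDivringClosed.Build {poly R} rees_pred rees_divring.

Definition rees := {p : {poly R} | rees_pred p}.
HB.instance Definition _ := SubChoice.on rees.
HB.instance Definition _ := [SubChoice_isSubIntegralDomain of rees by <:].

Lemma rees_component_subproof d (s : rees) :
  rees_pred ((val s)`_d *: 'X^d).
Proof.
apply/asboolP => i; rewrite coefZ coefXn.
case: eqP => [->|_]; rewrite ?mulr1 ?mulr0; last exact: ideal_pow0.
by case: s => s /= /asboolP.
Qed.

Definition rees_component d (s : rees) : rees :=
  Sub ((val s)`_d *: 'X^d) (rees_component_subproof d s).

Lemma rees_component_is_zmod d : zmod_morphism (rees_component d).
Proof.
move=> s t; apply: val_inj; rewrite [RHS]raddfB.
change ((val (s - t))`_d *: 'X^d =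
        (val s)`_d *: 'X^d - (val t)`_d *: 'X^d).
by rewrite raddfB coefB scalerBl.
Qed.

HB.instance Definition _ d :=
  GRing.isZmodMorphism.Build rees rees (rees_component d)
    (rees_component_is_zmod d).

Lemma rees_component_id d e s :
  rees_component d (rees_component e s) =
  if d == e then rees_component e s else 0.
Proof.
apply: val_inj; rewrite /= coefZ coefXn; case: eqP => [->|_] /=.
  by rewrite mulr1.
by rewrite mulr0 scale0r.
Qed.

Lemma rees_component_sum s :
  exists N, s = \sum_(d < N) rees_component d s.
Proof.
exists (size (val s)); apply: val_inj; rewrite rmorph_sum /=.
by rewrite -poly_def coefK.
Qed.

Lemma rees_component1 : rees_component 0 1 = 1.
Proof. by apply: val_inj; rewrite /= coef1 scale1r. Qed.

Lemma rees_componentM d e a b :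
  rees_component d a = a -> rees_component e b = b ->
  rees_component (d + e) (a * b) = a * b.
Proof.
move=> /(congr1 val) ha /(congr1 val) hb.
have {}ha : (val a)`_d *: 'X^d = val a := ha.
have {}hb : (val b)`_e *: 'X^e = val b := hb.
apply: val_inj.
change ((val (a * b))`_(d + e) *: 'X^(d + e) = val (a * b)).
have -> : val (a * b) = val a * val b := rmorphM val a b.
rewrite -ha -hb -scalerAl -scalerAr scalerA -exprD.
by rewrite coefZ coefXn eqxx mulr1.
Qed.

Definition rees_grading : grading rees :=
  Grading rees_component_id rees_component_sum rees_component1 rees_componentM.

(* The blowup of Spec R along I, Proj of the Rees algebra, is regular. *)
Definition tame : Prop := regular_proj rees_grading.

End Blowup.

Section Graphs.
Variable n : nat.

Definition simple_graph (e : rel 'I_n) : Prop :=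
  ssrbool.symmetric e /\ irreflexive e.

Definition edge_ideal (k : closedFieldType) (e : rel 'I_n) :
    {mpoly k[n]} -> Prop :=
  span (fun f => exists i j, e i j /\ f = 'X_i * 'X_j).

Definition tame_graph (k : closedFieldType) (e : rel 'I_n) : Prop :=
  tame (@edge_ideal k e).

Definition isolated (e : rel 'I_n) (v : 'I_n) : Prop := forall w, ~~ e v w.

(* The subgraph of e induced on W is complete bipartite. *)
Definition complete_bipartite_on (e : rel 'I_n) (W : {set 'I_n}) : Prop :=
  exists V1 V2 : {set 'I_n},
    [/\ W = V1 :|: V2, [disjoint V1 & V2] &
        {in W &, forall a b,
          e a b = (a \in V1) && (b \in V2) || (a \in V2) && (b \in V1)}].

Definition complete_bipartite_plus_isolated (e : rel 'I_n) : Prop :=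
  exists W : {set 'I_n},
    complete_bipartite_on e W /\ (forall v, v \notin W -> isolated e v).

End Graphs.

(* Main.v *)
(* A local ring of the blowup is regular exactly when its maximal ideal is
   generated by as many elements as its dimension, which is at most n by a
   transcendence degree count.

   If G is complete bipartite with parts V1 and V2, then I(G) is the product of
   the ideals of two coordinate subspaces, and the chart at an edge ab is the
   affine space with coordinates x_a, x_b, x_i / x_a for i in V1, x_j / x_b for
   j in V2, and x_l for the isolated vertices l. The local ring of k[x_1, .., x_n]
   at a prime q is regular: going from k[x_1, .., x_i] to k[x_1, .., x_(i+1)],
   either q is extended from the smaller ring, or both its height and its number
   of local generators grow by one.

   Conversely, the chart at an edge ab is the spectrum of the ring spanned by the
   Laurent monomials x^m / (x_a x_b)^d with x^m in I^d. Giving x_a and x_b weight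
   1 and the other variables weight 2 shows that 1 is the only invertible one, so
   that the indecomposable ones are linearly independent in the cotangent space
   at the origin of the chart. There are n obvious ones, and one more if a and b
   have a common neighbour, or if some edge disjoint from ab does not form a
   4-cycle with ab. If none of these occurs for any edge, G is complete bipartite
   up to isolated vertices. *)

From HB Require Import structures.
From mathcomp Require Import all_boot all_algebra.
From mathcomp Require Import ring_quotient fraction boolp mpoly ring zify.
Require Import Defs.

Set Implicit Arguments.
Unset Strict Implicit.
Unset Printing Implicit Defensive.

Import GRing.Theory.
Local Open Scope ring_scope.

(** * Ideals and algebraic independence *)

Section Ideals.
Variable A : comNzRingType.
Implicit Types (X : A -> Prop) (J p : {pred A}).

Lemma span0 X : span X 0.
Proof. by exists [::]; rewrite big_nil. Qed.

Lemma spanD X a b : span X a -> span X b -> span X (a + b).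
Proof.
move=> [s [hs ->]] [t [ht ->]]; exists (s ++ t); rewrite big_cat.
by split=> // c; rewrite mem_cat => /orP[/hs|/ht].
Qed.

Lemma spanMl X c a : span X a -> span X (c * a).
Proof.
move=> [s [hs ->]]; exists [seq (c * d.1, d.2) | d <- s]; split.
  by move=> _ /mapP[d /hs ? ->].
by rewrite big_map mulr_sumr; apply: eq_bigr => d _; rewrite mulrA.
Qed.

Lemma span_in X a : X a -> span X a.
Proof.
move=> Xa; exists [:: (1, a)]; rewrite big_seq1 mul1r; split=> // c.
by rewrite inE => /eqP ->.
Qed.

Lemma span_ind X (P : A -> Prop) : P 0 ->
  (forall a b, P a -> P b -> P (a + b)) ->
  (forall c a, X a -> P (c * a)) -> forall a, span X a -> P a.
Proof.
move=> P0 PD PM a [s [hs ->]]; rewrite big_seq.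
by elim/big_ind: _ => // c /hs; apply: PM.
Qed.

Lemma span_trans X (Y : A -> Prop) a :
  (forall x, X x -> span Y x) -> span X a -> span Y a.
Proof.
move=> XY; apply: span_ind; [exact: span0 | exact: spanD |].
by move=> c x /XY; apply: spanMl.
Qed.

Lemma submod_closedP J : 0 \in J -> {in J &, forall u v, u + v \in J} ->
  (forall a, {in J, forall u, a * u \in J}) -> @submod_closed A A^o J.
Proof.
by move=> J0 JD JM; split=> // a u v uJ vJ; apply: JD => //; apply: JM.
Qed.

Lemma span_submod J (X : A -> Prop) a : @submod_closed A A^o J ->
  (forall x, X x -> x \in J) -> span X a -> a \in J.
Proof.
move=> [J0 JD] XJ; apply: (span_ind (P := fun x => x \in J)) => //.
- by move=> x y xJ yJ; rewrite -[x]mul1r; apply: JD.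
- by move=> c x /XJ xJ; rewrite -[_ * _]addr0; apply: JD.
Qed.

Lemma idealr_submod J : idealr_closed J -> @submod_closed A A^o J.
Proof. by case. Qed.

Section SubmodTheory.
Variable J : {pred A}.
Hypothesis hJ : @submod_closed A A^o J.

Lemma submod0 : 0 \in J. Proof. by case: hJ. Qed.
Lemma submodMl a u : u \in J -> a * u \in J.
Proof. by case: hJ => J0 JD uJ; rewrite -[_ * _]addr0; apply: JD. Qed.
Lemma submodMr a u : u \in J -> u * a \in J.
Proof. by rewrite mulrC; apply: submodMl. Qed.
Lemma submodD u v : u \in J -> v \in J -> u + v \in J.
Proof. by case: hJ => J0 JD uJ vJ; rewrite -[u]mul1r; apply: JD. Qed.
Lemma submodN u : u \in J -> - u \in J.
Proof. by rewrite -mulN1r; apply: submodMl. Qed.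
Lemma submodB u v : u \in J -> v \in J -> u - v \in J.
Proof. by move=> uJ vJ; apply: submodD => //; apply: submodN. Qed.
Lemma submodDr u v : u \in J -> (v + u \in J) = (v \in J).
Proof.
move=> uJ; apply/idP/idP => [h|vJ]; last exact: submodD.
by rewrite -(addrK u v); apply: submodB.
Qed.
Lemma submod_sum I (r : seq I) (P : pred I) (F : I -> A) :
  (forall i, P i -> F i \in J) -> \sum_(i <- r | P i) F i \in J.
Proof.
by move=> h; elim/big_ind: _ => //; [exact: submod0 | exact: submodD].
Qed.
End SubmodTheory.

Section PrimeTheory.
Variable p : {pred A}.
Hypothesis hp : prime_ideal p.

Lemma prime_submod : @submod_closed A A^o p.
Proof. by case: hp => /idealr_submod. Qed.
Lemma prime1 : 1 \notin p. Proof. by case: hp => -[]. Qed.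
Lemma primeM a b : (a * b \in p) = (a \in p) || (b \in p).
Proof.
apply/idP/idP => [|/orP[]]; first by case: hp => _; apply.
  exact: submodMr prime_submod _ _.
exact: submodMl prime_submod _ _.
Qed.
Lemma prime_unit a b : a * b = 1 -> a \notin p.
Proof. by move=> ab; apply: contra prime1 => ap; rewrite -ab primeM ap. Qed.
End PrimeTheory.

Lemma noetherian_mem_span (hA : noetherian A) J : @submod_closed A A^o J ->
  exists2 s : seq A, {subset s <= J} &
    forall a, a \in J -> span (fun x => x \in s) a.
Proof.
move=> /hA[s hs]; exists s => [x xs|a]; last by rewrite hs.
by apply/hs/span_in.
Qed.

End Ideals.

Lemma noetherianP (A : comNzRingType) :
  (forall J : {pred A}, @submod_closed A A^o J ->
    exists2 s : seq A, {subset s <= J} &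
      forall a, a \in J -> span (fun x => x \in s) a) -> noetherian A.
Proof.
move=> h J hJ; have [s sJ Js] := h J hJ; exists s => a; split; first exact: Js.
exact: span_submod.
Qed.

Lemma preim_submod (A B : comNzRingType) (f : {rmorphism A -> B})
    (J : {pred B}) : @submod_closed B B^o J ->
  @submod_closed A A^o [pred a | f a \in J].
Proof.
move=> hJ; apply: submod_closedP => [|u v|a u]; rewrite !inE.
- by rewrite rmorph0 submod0.
- by rewrite rmorphD; apply: submodD.
- by rewrite rmorphM; apply: submodMl.
Qed.

Lemma preim_prime (A B : comNzRingType) (f : {rmorphism A -> B})
    (p : {pred B}) : prime_ideal p -> prime_ideal [pred a | f a \in p].
Proof.
move=> hp; have [_ hM] := hp; split; last by move=> u v; rewrite !inE rmorphM => /hM.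
have [h0 hD] := preim_submod f (prime_submod hp).
by split=> //; rewrite inE rmorph1 prime1.
Qed.

(** Modulo p' the element y vanishes and only the constant term survives, so that term is zero; the
    rest is a multiple of y, and y can be cancelled modulo p. *)
Lemma horner_indep (C B : comNzRingType) (zeta : {rmorphism C -> B})
    (p p' : {pred B}) y (cy : commr_rmorph zeta y) :
  prime_ideal p -> prime_ideal p' -> {subset p <= p'} ->
  y \in p' -> y \notin p -> (forall F, zeta F \in p' -> F = 0) ->
  forall F, horner_morph cy F \in p -> F = 0.
Proof.
move=> hp hp' pp' yp' yp zI; elim/poly_ind => //= F c IHF.
rewrite rmorphD rmorphM /= horner_morphX horner_morphC => h.
have c0 : c = 0.
  apply: zI; move/pp': (h); rewrite addrC (submodDr (prime_submod hp')) //.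
  exact: submodMl (prime_submod hp') _ _ yp'.
move: h; rewrite c0 rmorph0 addr0 primeM // (negPf yp) orbF => /IHF ->.
by rewrite mul0r addr0.
Qed.

(* k[X_1, .., X_n], the last variable being the outermost one. *)
Fixpoint iter_poly (k : fieldType) (n : nat) : idomainType :=
  if n is m.+1 then {poly (iter_poly k m)} else k.

Fixpoint iterC (k : fieldType) (n : nat) : {rmorphism k -> iter_poly k n} :=
  if n is m.+1 then (@polyC (iter_poly k m) \o iterC k m) else idfun.

Section Independence.
Variables (k : fieldType) (B : comNzRingType) (phi : {rmorphism k -> B}).

(* B / p contains r elements algebraically independent over k. *)
Definition indep (r : nat) (p : {pred B}) : Prop :=
  exists zeta : {rmorphism iter_poly k r -> B},
    (forall c, zeta (iterC k r c) = phi c) /\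
    (forall F, zeta F \in p -> F = 0).

Lemma indep0 (p : {pred B}) : prime_ideal p -> indep 0 p.
Proof.
move=> hp; exists phi; split=> //= c hc; apply/eqP; apply: contraTT hc => c0.
by apply: (prime_unit hp (b := phi c^-1)); rewrite -rmorphM mulfV ?rmorph1.
Qed.

Lemma indepS r (p p' : {pred B}) y : prime_ideal p -> prime_ideal p' ->
  {subset p <= p'} -> y \in p' -> y \notin p -> indep r p' -> indep r.+1 p.
Proof.
move=> hp hp' pp' yp' yp [zeta [zC zI]].
have cy : commr_rmorph zeta y by move=> x; apply: mulrC.
exists (horner_morph cy); split=> [c|]; first by rewrite /= horner_morphC.
exact: horner_indep pp' yp' yp zI.
Qed.

(** Going down the chain from p e, each strict inclusion yields one more independent element. The
    chain is shortened from the top, so r grows while e decreases. *)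
Lemma indep_chain e r (p : nat -> {pred B}) :
  prime_chain e p -> indep r (p e) -> indep (r + e) (p 0%N).
Proof.
elim: e p r => [|e IHe] p r [hp hs] hr; first by rewrite addn0.
have [sp [y yp' yp]] := hs e (ltnSn e).
rewrite addnS -addSn; apply: IHe.
  by split=> i ie; [apply: hp | apply: hs]; apply: leqW.
by apply: indepS sp yp' yp hr; apply: hp.
Qed.

End Independence.

Section Growth.
Variables (k : fieldType) (n : nat) (B : comNzRingType).
Variable iota : {rmorphism {mpoly k[n]} -> B}.
Hypothesis B_frac : forall y : B, exists a b : {mpoly k[n]},
  b != 0 /\ y * iota b = iota a.

Hypothesis iota_inj : injective iota.
Hypothesis B_integral : forall x y : B, x * y = 0 -> x = 0 \/ y = 0.

Lemma msizeM_leS (f g : {mpoly k[n]}) D E :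
  (msize f <= D.+1)%N -> (msize g <= E.+1)%N -> (msize (f * g) <= (D + E).+1)%N.
Proof.
have [->|f0] := eqVneq f 0; first by rewrite mul0r msize0.
have [->|g0] := eqVneq g 0; first by rewrite mulr0 msize0.
rewrite msizeM // => hf hg; rewrite -subn1 leq_subLR.
by apply: leq_trans (leq_add hf hg) _; rewrite addSn addnS add1n.
Qed.

Lemma msizeX_leS (f : {mpoly k[n]}) D j :
  (msize f <= D.+1)%N -> (msize (f ^+ j) <= (D * j).+1)%N.
Proof.
move=> hf; elim: j => [|j IHj]; first by rewrite expr0 muln0 msize1.
by rewrite exprS mulnS; apply: msizeM_leS.
Qed.

(** Induction on N: the family for the first variables is multiplied by the powers y^j, j < D, of
    the image y = a'/b' of the last one. Completing each denominator b'^j to b'^D gives all members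
    the common denominator b^D, with numerators of degree linear in D. *)
Lemma growth N (zeta : {rmorphism iter_poly k N -> B}) :
  (forall c, zeta (iterC k N c) = iota c%:MP) ->
  exists (b : {mpoly k[n]}) (E : nat), b != 0 /\
  forall D, exists (I : finType) (g : I -> iter_poly k N)
      (G : I -> {mpoly k[n]}),
    [/\ #|I| = (D ^ N)%N,
        forall c : I -> k, \sum_i iterC k N (c i) * g i = 0 ->
          forall i, c i = 0,
        forall i, (msize (G i) <= (E * D).+1)%N &
        forall i, iota (G i) = iota (b ^+ D) * zeta (g i)].
Proof.
elim: N zeta => [|N IHN] zeta zC.
  exists 1, 0%N; split=> [|D]; first exact: oner_neq0.
  exists unit, (fun=> 1), (fun=> 1); split.
  - by rewrite card_unit.
  - move=> c; rewrite (bigD1 tt) //= big1 => [|[]//].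
    by rewrite addr0 mulr1 => h [].
  - by move=> _; rewrite msize1.
  - by move=> _; rewrite expr1n !rmorph1 mulr1.
have [b [E [b0 hb]]] := IHN (zeta \o @polyC _) zC.
have [a' [b' [b'0 yb]]] := B_frac (zeta 'X).
pose E' := maxn (msize a') (msize b').
exists (b * b'), (E + E')%N; split=> [|D]; first by rewrite mulf_neq0.
have [I [g [G [cI gI sG hG]]]] := hb D.
exists (I * 'I_D)%type, (fun ij : (I * 'I_D)%type => (g ij.1)%:P * 'X^(ij.2)),
  (fun ij : (I * 'I_D)%type => G ij.1 * a' ^+ ij.2 * b' ^+ (D - ij.2)); split.
- by rewrite card_prod cI card_ord expnS mulnC.
- move=> c hc [i j]; apply: (gI (fun i => c (i, j))).
  have /(congr1 (fun F : {poly _} => F`_j)) := hc.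
  rewrite coef0 coef_sum => hcj; apply: etrans hcj.
  have key ij : ((iterC k N (c ij))%:P * ((g ij.1)%:P * 'X^(ij.2)))`_j =
      if ij.2 == j then iterC k N (c (ij.1, j)) * g ij.1 else 0.
    case: ij => i' j' /=; rewrite mulrA -polyCM coefCM coefXn eq_sym.
    case: eqVneq => [/val_inj -> | njj']; first by rewrite eqxx mulr1.
    by rewrite -val_eqE (negPf njj') mulr0.
  transitivity (\sum_(ij : I * 'I_D)
    if ij.2 == j then iterC k N (c (ij.1, j)) * g ij.1 else 0).
    rewrite -(pair_bigA _ (fun i j' =>
      if j' == j then iterC k N (c (i, j)) * g i else 0)) /=.
    by apply: eq_bigr => i' _; rewrite -big_mkcond big_pred1_eq.
  by apply: eq_bigr => ij _; rewrite -key.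
- move=> [i j] /=; have := ltn_ord j; rewrite mulnDl => jD.
  have ha : (msize (a' ^+ j) <= (E' * j).+1)%N.
    by apply: msizeX_leS; rewrite leqW // leq_maxl.
  have hb' : (msize (b' ^+ (D - j)) <= (E' * (D - j)).+1)%N.
    by apply: msizeX_leS; rewrite leqW // leq_maxr.
  apply: leq_trans (msizeM_leS (msizeM_leS (sG i) ha) hb') _.
  by rewrite ltnS -addnA -mulnDr subnKC // ltnW.
- move=> [i j] /=; rewrite !rmorphM hG /= !rmorphXn /= -yb !rmorphM !exprMn.
  have -> : iota b' ^+ D = iota b' ^+ j * iota b' ^+ (D - j).
    by rewrite -exprD subnKC // ltnW.
  set x := zeta _; set u := _ ^+ j; set v := _ ^+ j; set w := _ ^+ (D - j).
  set z := iota b ^+ D; ring.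
Qed.

(** The D^N independent elements of [growth] have a common denominator and numerators of degree
    O(D), hence lie in a space of dimension O(D^n). For large D this forces N <= n. *)
Lemma indep_bound N (zeta : {rmorphism iter_poly k N -> B}) :
  (forall c, zeta (iterC k N c) = iota c%:MP) ->
  (forall F, zeta F = 0 -> F = 0) -> (N <= n)%N.
Proof.
move=> zC zI; have [b [E [b0 hb]]] := growth zC.
rewrite leqNgt; apply/negP => nN.
(* With this D, (E D + 2)^n <= ((E + 2) D)^n < D^(n + 1); the left side counts the exponent vectors
   with entries at most E D + 1, which include those of all numerators. *)
pose D := (E.+2 ^ n).+1; have [I [g [G [cI gI sG hG]]]] := hb D.
pose J := {ffun 'I_n -> 'I_(E * D).+2}.
pose M : 'M[k]_(#|I|, #|J|) := \matrix_(i, j)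
  (G (enum_val i))@_[multinom ((enum_val j : J) l : nat) | l < n].
have cJ : (#|J| < #|I|)%N.
  rewrite cI card_ffun !card_ord; apply: (@leq_trans (D ^ n.+1)); last first.
    by rewrite leq_exp2l // /D ltnS expn_gt0.
  apply: (@leq_ltn_trans ((E.+2 * D) ^ n)).
    have le_base : ((E * D).+2 <= E.+2 * D)%N by rewrite /D; nia.
    by elim: (n) => // l IHl; rewrite !expnS leq_mul.
  by rewrite expnMn expnS ltn_pmul2r ?expn_gt0.
(* There are more rows than columns, so some nontrivial combination of the numerators vanishes. *)
have /rowV0Pn[v /sub_kermxP vM v0] : kermx M != 0.
  by rewrite kermx_eq0 /row_free ltn_eqF // (leq_ltn_trans (rank_leq_col M)).
pose c i := v 0 (enum_rank i).
have Gc : \sum_i (c i)%:MP * G i = 0.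
  apply/mpolyP => m; rewrite mcoeff0 raddf_sum /=.
  have [hm|hm] := leqP (E * D).+1 (mdeg m).
    rewrite big1 // => i _; rewrite mcoeffCM memN_msupp_eq0 ?mulr0 //.
    by apply: msize_mdeg_ge; apply: leq_trans (sG i) hm.
  pose f : J := [ffun l => inord (m l)].
  have fm : [multinom (f l : nat) | l < n] = m.
    apply/mnmP => l; rewrite mnmE ffunE inordK // ltnS.
    by apply: leq_trans hm; rewrite leqW // mdegE (bigD1 l) //= leq_addr.
  have /matrixP/(_ 0 (enum_rank f)) := vM; rewrite !mxE => {2}<-.
  rewrite (reindex_onto enum_val enum_rank) /= => [|i _]; last exact: enum_rankK.
  rewrite (eq_bigl xpredT) => [|i]; last by rewrite enum_valK eqxx.
  by apply: eq_bigr => i _; rewrite mcoeffCM mxE enum_rankK fm /c enum_valK.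
have gc : \sum_i iterC k N (c i) * g i = 0.
  apply: zI; set x := zeta _.
  suff /B_integral[|//] : iota (b ^+ D) * x = 0.
    by rewrite -(rmorph0 iota) => /iota_inj /eqP; rewrite expf_eq0 (negPf b0) andbF.
  rewrite -(rmorph0 iota) -Gc /x !rmorph_sum mulr_sumr; apply: eq_bigr => i _.
  by rewrite !rmorphM hG zC mulrCA.
case/eqP: v0; apply/rowP => i; rewrite mxE.
by have := gI c gc (enum_val i); rewrite /c enum_valK.
Qed.
End Growth.

(** * Hilbert's basis theorem *)

Lemma noetherian_field (k : fieldType) : noetherian k.
Proof.
apply: noetherianP => J hJ.
have [[a aJ a0]|J0] := pselect (exists2 a, a \in J & a != 0).
  exists [:: a] => [x|b _]; first by rewrite inE => /eqP ->.
  rewrite -[b](divfK a0); apply: spanMl; apply: span_in.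
  by rewrite inE.
exists [::] => // b bJ; suff -> : b = 0 by exact: span0.
by apply/eqP; apply: contrapT => /negP b0; apply: J0; exists b.
Qed.

(* Hilbert's basis theorem: L d is the ideal of the coefficients of degree d of
   the elements of J of degree at most d. The union of the chain L is reached at
   some D, and J is generated by elements representing generators of L d for
   d <= D. *)
Lemma noetherian_poly (A : comNzRingType) : noetherian A -> noetherian {poly A}.
Proof.
move=> hA; apply: noetherianP => J hJ.
pose R d a (f : {poly A}) := [/\ f \in J, (size f <= d.+1)%N & f`_d = a].
pose L d : {pred A} := fun a => `[< exists f, R d a f >].
have LP d a : reflect (exists f, R d a f) (a \in L d) by apply: asboolP.
have hL d : @submod_closed A A^o (L d).
  apply: submod_closedP => [|a b|c a].
  - by apply/LP; exists 0; rewrite /R submod0 // size_poly0 coef0.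
  - move=> /LP[f [fJ sf <-]] /LP[g [gJ sg <-]]; apply/LP; exists (f + g).
    rewrite /R submodD // coefD; split=> //.
    by apply: leq_trans (size_polyD _ _) _; rewrite geq_max sf.
  - move=> /LP[f [fJ sf <-]]; apply/LP; exists (c%:P * f).
    rewrite /R submodMl // coefCM; split=> //.
    by apply: leq_trans sf; rewrite mul_polyC size_scale_leq.
have L_mono d e : (d <= e)%N -> {subset L d <= L e}.
  move=> de a /LP[f [fJ sf <-]]; apply/LP; exists (f * 'X^(e - d)).
  rewrite /R submodMr // coefMXn; split=> //; last first.
    by rewrite ltnNge leq_subr /= subKn.
  apply: leq_trans (size_polyMleq _ _) _; rewrite size_polyXn; lia.
pose U : {pred A} := fun a => `[< exists d, a \in L d >].
have UP a : reflect (exists d, a \in L d) (a \in U) by apply: asboolP.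
have hU : @submod_closed A A^o U.
  apply: submod_closedP => [|a b|c a].
  - by apply/UP; exists 0%N; apply: submod0.
  - move=> /UP[d ad] /UP[e be]; apply/UP; exists (maxn d e).
    by apply: submodD => //; [apply: L_mono ad | apply: L_mono be];
      rewrite ?leq_maxl ?leq_maxr.
  - by move=> /UP[d ad]; apply/UP; exists d; apply: submodMl.
have [D hD] : exists D, {subset U <= L D}.
  have [s sU Us] := noetherian_mem_span hA hU.
  have [D sD] : exists D, {subset s <= L D}.
    elim: s sU {Us} => [|a s IHs] sU; first by exists 0%N.
    have /UP[d ad] := sU a (mem_head _ _).
    have [|D sD] := IHs; first by move=> x xs; apply: sU; rewrite inE xs orbT.
    exists (maxn d D) => x; rewrite inE => /predU1P[->|/sD].
      exact: L_mono (leq_maxl _ _) _ ad.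
    exact: L_mono (leq_maxr _ _) _.
  by exists D => a /Us; apply: span_submod => //.
have /choice[s hs] d : exists s : seq A, {subset s <= L d} /\
    forall a, a \in L d -> span (fun x => x \in s) a.
  by have [s sL Ls] := noetherian_mem_span hA (hL d); exists s.
have /choice[t ht] (da : nat * A) : exists f, da.2 \in L da.1 -> R da.1 da.2 f.
  have [/LP[f hf]|_] := boolP (da.2 \in L da.1); first by exists f.
  by exists 0.
pose T := flatten [seq [seq t (d, a) | a <- s d] | d <- iota 0 D.+1].
have tT d a : (d <= D)%N -> a \in s d -> t (d, a) \in T.
  move=> dD ads; apply/flattenP; exists [seq t (d, a) | a <- s d].
    by apply/mapP; exists d => //; rewrite mem_iota.
  by apply/mapP; exists a.
exists T => [f /flattenP[_ /mapP[d _ ->] /mapP[a as_ ->]]|f].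
  by have [sL _] := hs d; have [] := ht (d, a) (sL _ as_).
move: {2}(size f) (leqnn (size f)) => m; elim: m f => [|m IHm] f sf fJ.
  by move: sf; rewrite leqn0 size_poly_eq0 => /eqP ->; apply: span0.
(* The chain L is constant from D on, so the coefficient of degree m of f already lies in L d;
   multiplying by X^(m - d) restores the degree. *)
pose d := minn m D.
have dm : (d <= m)%N by apply: geq_minl.
have dD : (d <= D)%N by apply: geq_minr.
have aL : f`_m \in L d.
  have am : f`_m \in L m by apply/LP; exists f.
  rewrite /d; case: leqP => // mD; apply: hD; apply/UP; by exists m.
have [sL Ls] := hs d.
have [c [cs ca]] := Ls _ aL.
pose g := \sum_(x <- c) x.1%:P * 'X^(m - d) * t (d, x.2).
have gR x : x \in c -> R d x.2 (t (d, x.2)).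
  by move=> /cs /sL /(ht (d, x.2)).
have gT : span (fun x => x \in T) g.
  rewrite /g big_seq; elim/big_ind: _ => [||x xc]; [exact: span0|exact: spanD|].
  by apply/spanMl/span_in/tT => //; apply: cs.
have sg : (size g <= m.+1)%N.
  rewrite /g big_seq; elim/big_ind: _ => [|u v su sv|x xc].
  - by rewrite size_poly0.
  - by apply: leq_trans (size_polyD _ _) _; rewrite geq_max su.
  - have [_ st _] := gR x xc.
    apply: leq_trans (size_polyMleq _ _) _.
    have sx : (size (x.1%:P * 'X^(m - d))%R <= (m - d).+1)%N.
      by rewrite mul_polyC (leq_trans (size_scale_leq _ _)) // size_polyXn.
    by move: (leq_add sx st); rewrite addSn addnS subnK //; case: (_ + _)%N.
have gm : g`_m = f`_m.
  rewrite ca coef_sum big_seq [RHS]big_seq; apply: eq_bigr => x xc.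
  have [_ _ tx] := gR x xc.
  by rewrite -mulrA coefCM coefXnM ltnNge leq_subr /= subKn // tx.
rewrite -(subrK g f); apply: spanD => //; apply: IHm.
  apply/leq_sizeP => j; rewrite leq_eqVlt => /predU1P[<-|mj].
    by rewrite coefB gm subrr.
  by rewrite coefB !nth_default ?subrr // (leq_trans _ mj).
apply: submodB => //; apply: (span_submod hJ _ gT) => x.
move=> /flattenP[_ /mapP[e _ ->] /mapP[a as_ ->]].
by have [eL _] := hs e; have [] := ht (e, a) (eL _ as_).
Qed.

(** * Primes of polynomial rings *)

Section PolynomialExtension.
Variables (A : comNzRingType) (p : {pred A}).
Hypothesis hp : prime_ideal p.

Definition poly_ext : {pred {poly A}} := fun f => all (mem p) f.

Lemma poly_extP (f : {poly A}) :
  reflect (forall i, f`_i \in p) (f \in poly_ext).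
Proof.
apply: (iffP (all_nthP 0)) => [h i|h i _]; last exact: h.
have [/h //|sf] := ltnP i (size f).
by rewrite nth_default // submod0 //; apply: prime_submod.
Qed.

Lemma poly_extC c : (c%:P \in poly_ext) = (c \in p).
Proof.
apply/poly_extP/idP => [/(_ 0%N)|cp i]; rewrite coefC ?eqxx //.
by case: eqP => // _; apply: submod0 (prime_submod hp).
Qed.

Lemma poly_extMX (f : {poly A}) : (f * 'X \in poly_ext) = (f \in poly_ext).
Proof.
apply/poly_extP/poly_extP => h i; first by have := h i.+1; rewrite coefMX.
by rewrite coefMX; case: eqP => // _; apply: submod0 (prime_submod hp).
Qed.

Lemma poly_ext_submod : @submod_closed {poly A} {poly A}^o poly_ext.
Proof.
have hpS := prime_submod hp.
apply: submod_closedP => [|f g /poly_extP hf /poly_extP hg|g f /poly_extP hf].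
- by apply/poly_extP => i; rewrite coef0 submod0.
- by apply/poly_extP => i; rewrite coefD submodD.
- by apply/poly_extP => i; rewrite coefM submod_sum // => j _; apply: submodMl.
Qed.

Lemma poly_ext_prime : prime_ideal poly_ext.
Proof.
have [hE0 hE1] := poly_ext_submod.
split; first by split=> //; rewrite (poly_extC 1) prime1.
have extD := submodDr poly_ext_submod.
have cX (f : {poly A}) c : c \in p ->
    (f * 'X + c%:P \in poly_ext) = (f \in poly_ext).
  by move=> cp; rewrite extD ?poly_extC // poly_extMX.
elim/poly_ind => [|f c IHf] g; first by rewrite mul0r => ->.
have [cp|cp] := boolP (c \in p).
  rewrite cX // mulrDl extD.
    by rewrite mulrAC poly_extMX => /IHf.
  by apply: submodMr poly_ext_submod _ _ _; rewrite poly_extC.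
elim/poly_ind: g => [|g d IHg] h; first by rewrite hE0 orbT.
have dp : d \in p.
  move/poly_extP/(_ 0%N): h.
  by rewrite coef0M !coefD !coefMX !coefC /= !add0r primeM // (negPf cp).
rewrite [X in _ || X]cX //; apply: IHg; rewrite -poly_extMX -mulrA.
move: h; rewrite mulrDr extD //.
by apply: submodMl poly_ext_submod _ _ _; rewrite poly_extC.
Qed.

End PolynomialExtension.

Section LocalGenerators.
Variable k : fieldType.

(* Every prime q has a regular system of parameters: with d the height of q,
   there are d elements generating q locally at q, and the residue field at q
   has transcendence degree n - d over k. *)
Definition has_parameters (A : comNzRingType) (phi : {rmorphism k -> A}) n :=
  forall q : {pred A}, prime_ideal q -> exists d r,
  [/\ (d + r = n)%N,
      exists2 P, prime_chain d P & P d =i q,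
      exists2 f : d.-tuple A, {subset f <= q} &
        forall g, g \in q ->
          exists2 s, s \notin q & span (fun x => x \in f) (s * g) &
      indep phi r q].

Lemma has_parameters_field : has_parameters (idfun : {rmorphism k -> k}) 0.
Proof.
move=> q hq; exists 0%N, 0%N; split=> //; last exact: indep0.
- exists (fun=> q) => //; split=> // i _.
- exists [tuple] => // g gq; exists 1; first exact: prime1.
  suff -> : g = 0 by rewrite mulr0; apply: span0.
  apply/eqP; apply: contraTT gq => g0.
  by apply: (prime_unit hq (b := g^-1)); rewrite mulfV.
Qed.

Lemma poly_ext_chain (A : comNzRingType) d (P : nat -> {pred A}) :
  prime_chain d P -> prime_chain d (fun i => poly_ext (P i)).
Proof.
move=> [hP hS]; split=> [i /hP|i id]; first exact: poly_ext_prime.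
have [sP [a ai1 ai]] := hS i id; split.
  by move=> f /(poly_extP (hP _ (ltnW id))) h; apply/(poly_extP (hP _ id)) => j;
    apply/sP/h.
by exists a%:P; rewrite poly_extC //; apply: hP => //; apply: ltnW.
Qed.

(** Let q0 be the contraction of q to A. If q = q0[X], the generators of q0 still work and X is a
    new independent element of the residue field. Otherwise q0[X] < q lengthens the chain by one,
    and one polynomial g joins the generators. *)
Lemma has_parameters_poly (A : comNzRingType) (phi : {rmorphism k -> A}) n :
  has_parameters phi n ->
  has_parameters (@polyC A \o phi : {rmorphism k -> {poly A}}) n.+1.
Proof.
move=> hA q hq.
pose q0 : {pred A} := [pred a | a%:P \in q].
have hq0 : prime_ideal q0 by apply: (preim_prime (@polyC A)).
have [d [r [dr [P hP Pd] [f fq hf] [zeta [zC zI]]]]] := hA _ hq0.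
have qS := prime_submod hq.
have q0q g : g \in poly_ext q0 -> g \in q.
  move=> /(poly_extP hq0) h; rewrite -[g]coefK poly_def.
  by apply: submod_sum => // i _; rewrite -mul_polyC; apply: submodMr => //;
    apply: h.
have fP : {subset map_tuple (@polyC A) f <= q}.
  by move=> _ /mapP[x /fq xq ->].
have hf0 a : a \in q0 -> exists2 s, s \notin q0 &
    span (fun x => x \in map_tuple (@polyC A) f) (s * a)%:P.
  move=> /hf[s sq sf]; exists s => //.
  apply: (span_ind (P := fun a => span _ a%:P)) sf.
  - exact: span0.
  - by move=> u v; rewrite polyCD; apply: spanD.
  - by move=> c x xf; rewrite polyCM; apply/spanMl/span_in/map_f.
have hPE : prime_chain d (fun i => poly_ext (P i)) by apply: poly_ext_chain.
have PE : poly_ext (P d) =i poly_ext q0.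
  by move=> g; apply: eq_all.
have [q0E|] := pselect (forall g, g \in q -> g \in poly_ext q0).
  exists d, r.+1; split.
  - by rewrite addnS dr.
  - exists (fun i => poly_ext (P i)) => // g; rewrite PE.
    by apply/idP/idP => [/q0q|/q0E].
  - exists (map_tuple (@polyC A) f) => // g /q0E.
    elim/poly_ind: g => [|g c IHg].
      by move=> _; exists 1; [apply: prime1 | rewrite mulr0; apply: span0].
    move=> h; have cq : c \in q0.
      by move/(poly_extP hq0)/(_ 0%N): (h); rewrite coefD coefMX coefC add0r.
    have /IHg[s sq sf] : g \in poly_ext q0.
      apply/(poly_extP hq0) => i; move/(poly_extP hq0)/(_ i.+1): h.
      by rewrite coefD coefMX coefC addr0.
    have [u uq uf] := hf0 _ cq.
    (* Each coefficient needs its own multiplier outside q; the product of the multipliers serves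
       for all of them. *)
    exists (u%:P * s); first by rewrite primeM // negb_or sq andbT.
    rewrite mulrDr; apply: spanD.
      by rewrite mulrA mulrC; apply: spanMl; rewrite -mulrA; apply: spanMl.
    by rewrite mulrAC -polyCM mulrC; apply: spanMl.
  - exists (map_poly zeta : {rmorphism {poly iter_poly k r} -> {poly A}}).
    split=> [c|F /q0E /(poly_extP hq0) h]; first by rewrite /= map_polyC /= zC.
    by apply/polyP => i; rewrite coef0; apply: zI; have := h i; rewrite coef_map.
move=> /existsNP[h /not_implyP[hq' /negP h0]].
(* The new generator g is an element of q of least degree among those whose leading coefficient is
   invertible at q. *)
pose D m :=
  `[< exists g : {poly A}, [/\ g \in q, size g = m.+1 & g`_m \notin q0] >].
have lead (g : {poly A}) m : g \in q -> (size g <= m.+1)%N -> g`_m \in q0 ->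
    g - (g`_m)%:P * 'X^m \in q /\ (size (g - (g`_m)%:P * 'X^m)%R <= m)%N.
  move=> gq sg gm; split.
    by apply: submodB => //; apply: submodMr.
  apply/leq_sizeP => j; rewrite coefB coefCM coefXn leq_eqVlt.
  case/predU1P => [->|mj]; first by rewrite eqxx mulr1 subrr.
  by rewrite nth_default ?(leq_trans sg) // gtn_eqF // mulr0 subr0.
(* Removing a leading term with coefficient in q0 keeps an element in q and outside q0[X]; this must
   stop at a leading coefficient outside q0. *)
have exD : exists m, D m.
  move: {2}(size h) (leqnn (size h)) => m; elim: m h hq' h0 => [|m IHm] h hq' h0 sh.
    case/negP: h0; apply/(poly_extP hq0) => i.
    by rewrite nth_default ?(leq_trans sh) // submod0 //; apply: prime_submod.
  have [hm|hm] := boolP (h`_m \in q0); last first.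
    exists m; apply/asboolP; exists h; split=> //; apply/eqP.
    rewrite eqn_leq sh ltnNge; apply: contra hm => hm.
    by rewrite nth_default // submod0 //; apply: prime_submod.
  have [h1q sh1] := lead h m hq' sh hm; apply: IHm h1q _ sh1.
  apply: contra h0 => h1; rewrite -[h](subrK ((h`_m)%:P * 'X^m)).
  apply: (submodD (poly_ext_submod hq0)) => //.
  by apply: submodMr (poly_ext_submod hq0) _ _ _; rewrite poly_extC.
case: (ex_minnP exD) => m /asboolP[g [gq sg gm]] m_min {exD}.
exists d.+1, r; split.
- by rewrite addSn dr.
- exists (fun i => if (i <= d)%N then poly_ext (P i) else q); last by rewrite ltnn.
  split=> [i _|i]; first by case: leqP => // id; apply: hPE.1.
  rewrite ltnS => id; rewrite id; move: id; rewrite leq_eqVlt => /predU1P[->|id].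
    rewrite ltnn; split=> [u|]; first by rewrite PE; apply: q0q.
    by exists g => //; rewrite PE; apply: contra gm => /(poly_extP hq0).
  by rewrite id; apply: hPE.2.
- exists [tuple of g :: map_tuple (@polyC A) f].
    by move=> u; rewrite inE => /predU1P[->|/fP].
  have fg u : span (fun x => x \in map_tuple (@polyC A) f) u ->
      span (fun x => x \in [tuple of g :: map_tuple (@polyC A) f]) u.
    by apply: span_trans => x xf; apply: span_in; rewrite inE xf orbT.
  move=> u; move: {2}(size u) (leqnn (size u)) => M.
  elim: M u => [|M IHM] u su uq.
    move: su; rewrite leqn0 size_poly_eq0 => /eqP ->.
    by exists 1; [apply: prime1 | rewrite mulr0; apply: span0].
  have [uM|uM] := boolP (u`_M \in q0).
    have [u1q su1] := lead u M uq su uM; have [s sq sf] := IHM _ su1 u1q.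
    have [v vq vf] := hf0 _ uM.
    exists (v%:P * s); first by rewrite primeM // negb_or sq andbT.
    rewrite -[u in _ * u](subrK ((u`_M)%:P * 'X^M)) mulrDr; apply: spanD.
      by rewrite -mulrA; apply: spanMl.
    have -> : v%:P * s * ((u`_M)%:P * 'X^M) = s * 'X^M * (v * u`_M)%:P.
      by rewrite polyCM; ring.
    by apply/spanMl/fg.
  have mM : (m <= M)%N.
    apply: m_min; apply/asboolP; exists u; split=> //; apply/eqP.
    rewrite eqn_leq su ltnNge; apply: contra uM => uM.
    by rewrite nth_default // submod0 //; apply: prime_submod.
  (* Pseudo-division of u by g, possible since m <= M by minimality. It multiplies u by the leading
     coefficient of g, which lies outside q. *)
  pose w := (g`_m)%:P * u - (u`_M)%:P * 'X^(M - m) * g.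
  have /IHM[] : (size w <= M)%N.
    apply/leq_sizeP => j; rewrite leq_eqVlt coefB -mulrA !coefCM coefXnM.
    case/predU1P => [<-|Mj].
      by rewrite ltnNge leq_subr /= subKn // mulrC subrr.
    rewrite [u`_j]nth_default ?(leq_trans su) // mulr0 sub0r.
    by rewrite ifN ?[g`_(_)]nth_default ?mulr0 ?oppr0 // ?sg -?leqNgt; lia.
  - by apply: submodB => //; apply: submodMl.
  move=> s sq sw; exists (s * (g`_m)%:P).
    by rewrite primeM // negb_or sq.
  rewrite -mulrA -[_ * u](subrK ((u`_M)%:P * 'X^(M - m) * g)) mulrDr.
  apply: spanD => //; apply/spanMl/spanMl/span_in; exact: mem_head.
- exists (@polyC A \o zeta); split=> [c|F /= hF]; first by rewrite /= zC.
  exact: zI.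
Qed.

Lemma iter_poly_noetherian n : noetherian (iter_poly k n).
Proof.
elim: n => [|n IHn]; first exact: noetherian_field.
exact: noetherian_poly IHn.
Qed.

Lemma iter_poly_has_parameters n : has_parameters (iterC k n) n.
Proof.
elim: n => [|n IHn]; first exact: has_parameters_field.
exact: has_parameters_poly IHn.
Qed.
End LocalGenerators.

(** * Regularity of the localizations of polynomial rings *)

Lemma local_of_units (B : comNzRingType) (m : {pred B}) :
  idealr_closed m -> (forall b, b \notin m -> exists u, b * u = 1) ->
  local_with m.
Proof.
move=> hm hU.
have sub (J : {pred B}) : idealr_closed J -> {subset J <= m}.
  move=> hJ x xJ; apply: contraT => /hU[u xu]; have [_ /negP[]] := hJ.
  by rewrite -xu submodMr //; apply: idealr_submod.
split=> [|m' [hm' max_m']]; last first.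
  by move=> x; apply/esym; apply: max_m' => //; apply: sub.
split=> // J hJ mJ x; apply/idP/idP => [|/mJ //]; exact: sub.
Qed.

Section Localization.
Variables (k : fieldType) (n : nat) (B : comNzRingType) (m : {pred B}).
Variable sigma : {rmorphism iter_poly k n -> B}.
Hypotheses (m_prime : prime_ideal m)
  (m_units : forall b, b \notin m -> exists u, b * u = 1).
Hypotheses (sigma_inj : injective sigma)
  (sigma_frac : forall b, exists f g,
     sigma g \notin m /\ b * sigma g = sigma f).

Let q : {pred iter_poly k n} := [pred f | sigma f \in m].

Let q_prime : prime_ideal q. Proof. exact: preim_prime. Qed.

Definition loc_ideal (P : {pred iter_poly k n}) : {pred B} := fun b =>
  `[< exists f g, [/\ sigma g \notin m, f \in P & b * sigma g = sigma f] >].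

(** For another representation f'/g' of b with f' in P, cross-multiplication puts f g' in P, and g'
    is outside P because P lies in q. *)
Lemma loc_idealE (P : {pred iter_poly k n}) b f g : prime_ideal P ->
  {subset P <= q} -> sigma g \notin m -> b * sigma g = sigma f ->
  (b \in loc_ideal P) = (f \in P).
Proof.
move=> hP Pq gm bf; apply/asboolP/idP => [[f' [g' [g'm f'P bf']]]|fP].
  have : f * g' \in P.
    suff -> : f * g' = f' * g by rewrite primeM // f'P.
    by apply: sigma_inj; rewrite !rmorphM -bf -bf' mulrAC.
  rewrite primeM // => /orP[//|/Pq].
  by rewrite inE (negPf g'm).
by exists f, g.
Qed.

Lemma loc_ideal_prime (P : {pred iter_poly k n}) : prime_ideal P ->
  {subset P <= q} -> prime_ideal (loc_ideal P).
Proof.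
move=> hP Pq; have PS := prime_submod hP.
have E b f g := @loc_idealE P b f g hP Pq.
have nM (x y : B) : x \notin m -> y \notin m -> x * y \notin m.
  by rewrite primeM // negb_or => -> ->.
have m1 : sigma 1 \notin m by rewrite rmorph1 prime1.
split; [split|].
- by rewrite (E 0 0 1) // ?submod0 // rmorph0 mul0r.
- by rewrite (E 1 1 1) // ?prime1 // mul1r.
- move=> a x y; have [f [g [gm af]]] := sigma_frac a.
  have [f' [g' [gm' xf]]] := sigma_frac x.
  have [f'' [g'' [gm'' yf]]] := sigma_frac y.
  rewrite (E x f' g') // (E y f'' g'') // => f'P f''P.
  rewrite (E _ (f * f' * g'' + f'' * g * g') (g * g' * g'')).
  + apply: submodD => //; apply: submodMr => //; first exact: submodMl.
    exact: submodMr.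
  + by rewrite !rmorphM !nM.
  + by rewrite !rmorphD !rmorphM -af -xf -yf; ring.
- move=> x y; have [f [g [gm xf]]] := sigma_frac x.
  have [f' [g' [gm' yf]]] := sigma_frac y.
  have ggm : sigma (g * g') \notin m by rewrite rmorphM nM.
  have xyf : x * y * sigma (g * g') = sigma (f * f').
    by rewrite !rmorphM -xf -yf; ring.
  by rewrite (E _ _ _ gm xf) (E _ _ _ gm' yf) (E _ _ _ ggm xyf) primeM.
Qed.

Hypothesis B_dim : forall e r P, prime_chain e P ->
  indep (sigma \o iterC k n) r (P e) -> (r + e <= n)%N.

(** Let d be the height of q and r = n - d. The chain of primes ending at q extends to B, so the
    dimension is at least d. Modulo the top of any chain of length e in B, the r elements
    independent modulo q stay independent, so r + e <= n and e <= d. The d local generators of q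
    generate m, since their multipliers become units. *)
Lemma regular_localization : regular_local_ring B.
Proof.
have mS := prime_submod m_prime.
have qU g : sigma g \notin m -> exists u, sigma g * u = 1 by apply: m_units.
have qm f : (f \in q) = (sigma f \in m) by [].
have sigma_span (s : seq (iter_poly k n)) f : span (fun x => x \in s) f ->
    span (fun x => x \in map sigma s) (sigma f).
  apply: (span_ind (P := fun f => span _ (sigma f))).
  - by rewrite rmorph0; apply: span0.
  - by move=> x y; rewrite rmorphD; apply: spanD.
  - by move=> c x xs; rewrite rmorphM; apply/spanMl/span_in/map_f.
split.
  apply: noetherianP => J hJ.
  have [s sJ Js] := noetherian_mem_span (@iter_poly_noetherian k n)
    (preim_submod sigma hJ).
  exists (map sigma s) => [_ /mapP[f /sJ fJ ->] //|b bJ].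
  have [f [g [gm bf]]] := sigma_frac b; have [u gu] := qU g gm.
  rewrite -[b]mulr1 -gu mulrA bf mulrC; apply/spanMl/sigma_span/Js.
  by rewrite inE -bf submodMr.
have [d [r [dr [P hP Pd] [f fq hf] [zeta [zC zI]]]]] :=
  iter_poly_has_parameters q_prime.
exists m, d; split.
- by apply: local_of_units m_units; case: m_prime.
- split=> [|e Q hQ].
    have Pq i : (i <= d)%N -> {subset P i <= q}.
      move=> id; rewrite -(subKn id).
      elim: (d - i)%N (leq_subr i d) => [_ x|j IHj jd x]; first by rewrite subn0 Pd.
      move=> xP; apply: IHj (ltnW jd) _ _; rewrite -(subnSK jd).
      by apply: (hP.2 _ _).1 xP; rewrite ltn_subrL (leq_trans _ jd).
    exists (loc_ideal \o P); split=> [i id|i id] /=.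
      by apply: loc_ideal_prime; [apply: hP.1 | apply: Pq].
    have [sP [x xi1 xi]] := hP.2 i id.
    have Pp := hP.1 _ (ltnW id); have Pp1 := hP.1 _ id.
    split=> [b|].
      have [a [g [gm ba]]] := sigma_frac b.
      rewrite (loc_idealE Pp (Pq _ (ltnW id)) gm ba).
      by rewrite (loc_idealE Pp1 (Pq _ id) gm ba) => /sP.
    have m1 : sigma 1 \notin m by rewrite rmorph1 prime1.
    have x1 : sigma x * sigma 1 = sigma x by rewrite rmorph1 mulr1.
    exists (sigma x); first by rewrite (loc_idealE Pp1 (Pq _ id) m1 x1).
    by rewrite (loc_idealE Pp (Pq _ (ltnW id)) m1 x1).
  suff : (r + e <= n)%N by rewrite -dr addnC leq_add2r.
  apply: (B_dim hQ); exists (sigma \o zeta); split=> [c|F]; first by rewrite /= zC.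
  move=> h; apply: zI; rewrite qm; apply: contraLR h => /m_units[u].
  by move=> su; apply: (prime_unit (hQ.1 _ (leqnn e)) su).
- exists (map_tuple sigma f) => b; split=> [bm|]; last first.
    apply: span_submod => // _ /mapP[x /fq xq ->] //.
  have [a [g [gm ba]]] := sigma_frac b; have [u gu] := qU g gm.
  have /hf[s sq sf] : a \in q by rewrite qm -ba submodMr.
  have [v sv] := qU s sq.
  rewrite -[b]mulr1 -gu mulrA ba -[sigma a]mul1r -sv [sigma s * v]mulrC.
  by rewrite -[v * _ * _]mulrA -rmorphM mulrC; apply/spanMl/spanMl/sigma_span.
Qed.

End Localization.

(** * Local rings of a blowup *)

Local Notation "x %:F" := (FracField.tofrac x).

Section Stalks.
Variables (S : idomainType) (G : grading S) (p : proj_point G).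

(** The equation x = a / b in cross-multiplied form; computations in the stalk are done on such
    representatives. *)
Definition stalk_frac (x : stalk p) d (a b : S) : Prop :=
  [/\ homogeneous G d a, homogeneous G d b, b \notin p &
      val x * b%:F = a%:F].

Lemma notin_point_neq0 b : b \notin p -> b%:F != 0.
Proof.
rewrite tofrac_eq0; apply: contraNneq => ->.
exact: submod0 (prime_submod (point_prime p)).
Qed.

Lemma stalk_fracP (x : stalk p) : exists d a b, stalk_frac x d a b.
Proof.
have /asboolP[d [a [b [ha hb bp xE]]]] := valP x.
exists d, a, b; split=> //; rewrite -[LHS]/(\val x * b%:F) xE.
by rewrite divfK // notin_point_neq0.
Qed.

Lemma stalk_of_frac d (a b : S) : homogeneous G d a -> homogeneous G d b ->
  b \notin p -> exists x : stalk p, stalk_frac x d a b.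
Proof.
move=> ha hb bp; have xP : stalk_pred p (a%:F / b%:F).
  by apply/asboolP; exists d, a, b.
exists (Sub _ xP : stalk p); split=> //.
by rewrite SubK divfK // notin_point_neq0.
Qed.

Lemma stalk_frac_cross (x : stalk p) d a b d' a' b' :
  stalk_frac x d a b -> stalk_frac x d' a' b' -> a * b' = a' * b.
Proof.
move=> [_ _ _ xa] [_ _ _ xa']; apply/eqP; rewrite -tofrac_eq !tofracM -xa -xa'.
by rewrite mulrAC.
Qed.

Lemma stalk_frac_eq (x y : stalk p) d a b d' a' b' :
  stalk_frac x d a b -> stalk_frac y d' a' b' -> a * b' = a' * b -> x = y.
Proof.
move=> [_ _ bp xa] [_ _ bp' ya] /(congr1 (@FracField.tofrac S)).
rewrite !tofracM -xa -ya mulrAC => /(mulIf (notin_point_neq0 bp)).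
by move=> /(mulIf (notin_point_neq0 bp')) /val_inj.
Qed.

Lemma stalk_fracD (x y : stalk p) d a b d' a' b' :
  stalk_frac x d a b -> stalk_frac y d' a' b' ->
  stalk_frac (x + y) (d + d') (a * b' + a' * b) (b * b').
Proof.
move=> [ha hb bp xa] [ha' hb' bp' ya]; split.
- rewrite /homogeneous raddfD /= componentM //; congr (_ + _).
  by rewrite addnC componentM.
- exact: componentM.
- by rewrite (primeM (point_prime p)) negb_or bp.
- rewrite tofracD !tofracM -xa -ya; rewrite -[val (x + y)]/(val x + val y).
  by ring.
Qed.

Lemma stalk_fracM (x y : stalk p) d a b d' a' b' :
  stalk_frac x d a b -> stalk_frac y d' a' b' ->
  stalk_frac (x * y) (d + d') (a * a') (b * b').
Proof.
move=> [ha hb bp xa] [ha' hb' bp' ya]; split; try exact: componentM.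
- by rewrite (primeM (point_prime p)) negb_or bp.
- rewrite !tofracM -xa -ya; rewrite -[val (x * y)]/(val x * val y).
  by ring.
Qed.

Lemma stalk_frac0 : stalk_frac 0 0 0 1.
Proof.
split; first exact: raddf0; first exact: component1.
  exact: prime1 (point_prime p).
by rewrite tofrac0 -[val 0]/(0 : {fraction S}) mul0r.
Qed.

Lemma stalk_frac1 : stalk_frac 1 0 1 1.
Proof.
split; [exact: component1 | exact: component1 | |].
  exact: prime1 (point_prime p).
by rewrite tofrac1 -[val 1]/(1 : {fraction S}) mul1r.
Qed.

Lemma stalk_integral (x y : stalk p) : x * y = 0 -> x = 0 \/ y = 0.
Proof.
move=> /(congr1 val); rewrite -[val (x * y)]/(val x * val y).
by move=> /eqP; rewrite mulf_eq0 => /orP[] /eqP h; [left | right]; apply: val_inj.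
Qed.

Definition stalk_max : {pred stalk p} := fun x =>
  `[< exists d a b, stalk_frac x d a b /\ a \in p >].

Lemma stalk_maxE (x : stalk p) d a b :
  stalk_frac x d a b -> (x \in stalk_max) = (a \in p).
Proof.
move=> xa; have pP := point_prime p.
apply/asboolP/idP => [[d' [a' [b' [xa' ap']]]]|ap]; last by exists d, a, b.
have := stalk_frac_cross xa xa'; have [_ _ bp' _] := xa'.
move/(congr1 (fun z => z \in (p : {pred S}))).
by rewrite !(primeM pP) ap' (negPf bp') orbF /=.
Qed.

Lemma stalk_max_prime : prime_ideal stalk_max.
Proof.
have pP := point_prime p; have pS := prime_submod pP.
split; [split|].
- by rewrite (stalk_maxE stalk_frac0) submod0.
- by rewrite (stalk_maxE stalk_frac1) prime1.
- move=> c x y; have [d [a [b ca]]] := stalk_fracP c.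
  have [d' [a' [b' xa]]] := stalk_fracP x.
  have [d'' [a'' [b'' ya]]] := stalk_fracP y.
  rewrite (stalk_maxE xa) (stalk_maxE ya).
  rewrite (stalk_maxE (stalk_fracD (stalk_fracM ca xa) ya)) => ap' ap''.
  by apply: submodD => //; apply: submodMr => //; apply: submodMl.
- move=> x y; have [d [a [b xa]]] := stalk_fracP x.
  have [d' [a' [b' ya]]] := stalk_fracP y.
  rewrite (stalk_maxE xa) (stalk_maxE ya) (stalk_maxE (stalk_fracM xa ya)).
  by rewrite primeM.
Qed.

Lemma stalk_units (x : stalk p) : x \notin stalk_max -> exists u, x * u = 1.
Proof.
have [d [a [b xa]]] := stalk_fracP x; rewrite (stalk_maxE xa) => ap.
have [ha hb bp _] := xa; have [u ub] := stalk_of_frac hb ha ap.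
exists u; apply: stalk_frac_eq (stalk_fracM xa ub) stalk_frac1 _.
by rewrite mulr1 mul1r mulrC.
Qed.

Lemma stalk_local : local_with stalk_max.
Proof. by apply: local_of_units stalk_units; case: stalk_max_prime. Qed.

End Stalks.

Section ReesStalks.
Variables (R : idomainType) (I : R -> Prop).
Implicit Type p : proj_point (rees_grading I).

Lemma rees_mono_subproof d (f : R) : ideal_pow I d f -> rees_pred I (f *: 'X^d).
Proof.
move=> hf; apply/asboolP => i; rewrite coefZ coefXn.
by case: eqP => [->|_]; rewrite ?mulr1 ?mulr0 //; apply: ideal_pow0.
Qed.

Lemma rees_homog d (s : rees I) : homogeneous (rees_grading I) d s ->
  val s = (val s)`_d *: 'X^d.
Proof. by move=> /(congr1 val) hs; rewrite -[LHS]hs. Qed.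

Lemma rees_coef d (s : rees I) : ideal_pow I d (val s)`_d.
Proof. by case: s => s /= /asboolP. Qed.

(* f t^d, or the junk value 0 if f is not in I^d. *)
Definition rees_of d (f : R) : rees I := insubd 0 (f *: 'X^d).

Lemma val_rees_of d f : ideal_pow I d f -> val (rees_of d f) = f *: 'X^d.
Proof. by move=> hf; rewrite /rees_of insubdK //; apply: rees_mono_subproof. Qed.

Lemma rees_of_homog d f : ideal_pow I d f ->
  homogeneous (rees_grading I) d (rees_of d f).
Proof.
move=> hf; apply: val_inj; rewrite -[LHS]/((val (rees_of d f))`_d *: 'X^d).
by rewrite val_rees_of // coefZ coefXn eqxx mulr1.
Qed.

Lemma rees_ofM d e f g : ideal_pow I d f -> ideal_pow I e g ->
  rees_of d f * rees_of e g = rees_of (d + e) (f * g).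
Proof.
move=> hf hg; apply: val_inj; rewrite val_rees_of; last exact: ideal_powM.
rewrite -[LHS]/(val (rees_of d f) * val (rees_of e g)) !val_rees_of //.
by rewrite -scalerAl -scalerAr scalerA -exprD.
Qed.

Lemma rees_of_coef d (s : rees I) : homogeneous (rees_grading I) d s ->
  s = rees_of d (val s)`_d.
Proof.
move=> hs; apply: val_inj; rewrite val_rees_of; last exact: rees_coef.
exact: rees_homog.
Qed.

Lemma rees_of_inj d f g : ideal_pow I d f -> ideal_pow I d g ->
  rees_of d f = rees_of d g -> f = g.
Proof.
move=> hf hg /(congr1 (fun s : rees I => (val s)`_d)).
by rewrite !val_rees_of // !coefZ coefXn eqxx !mulr1.
Qed.

Lemma rees_of1 : rees_of 0 1 = 1.
Proof. by apply: val_inj; rewrite val_rees_of // scale1r. Qed.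

Lemma rees_of0 d : rees_of d 0 = 0.
Proof.
by apply: val_inj; rewrite val_rees_of ?scale0r //; apply: ideal_pow0.
Qed.

Variable p : proj_point (rees_grading I).

(* x = f / g with f, g in I^d, that is x = (f t^d) / (g t^d). *)
Definition rees_frac (x : stalk p) d (f g : R) : Prop :=
  [/\ ideal_pow I d f, ideal_pow I d g, rees_of d g \notin p &
      stalk_frac x d (rees_of d f) (rees_of d g)].

Lemma rees_fracP (x : stalk p) : exists d f g, rees_frac x d f g.
Proof.
have [d [a [b xa]]] := stalk_fracP x; have [ha hb bp _] := xa.
exists d, (val a)`_d, (val b)`_d; split; try exact: rees_coef.
  by rewrite -rees_of_coef.
by rewrite -!rees_of_coef.
Qed.

Lemma rees_frac_exists d f g : ideal_pow I d f -> ideal_pow I d g ->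
  rees_of d g \notin p -> exists x : stalk p, rees_frac x d f g.
Proof.
move=> hf hg gp.
have [x xf] := stalk_of_frac (rees_of_homog hf) (rees_of_homog hg) gp.
by exists x.
Qed.

Lemma rees_frac_cross (x : stalk p) d f g d' f' g' :
  rees_frac x d f g -> rees_frac x d' f' g' -> f * g' = f' * g.
Proof.
move=> [hf hg gp xf] [hf' hg' gp' xf'].
have := stalk_frac_cross xf xf'; rewrite !rees_ofM // [(d' + d)%N]addnC.
by apply: rees_of_inj; [|rewrite addnC]; apply: ideal_powM.
Qed.

Lemma rees_frac_eq (x y : stalk p) d f g d' f' g' :
  rees_frac x d f g -> rees_frac y d' f' g' -> f * g' = f' * g -> x = y.
Proof.
move=> [hf hg gp xf] [hf' hg' gp' yf] fg.
by apply: stalk_frac_eq xf yf _; rewrite !rees_ofM // fg addnC.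
Qed.

Lemma rees_fracM (x y : stalk p) d f g d' f' g' :
  rees_frac x d f g -> rees_frac y d' f' g' ->
  rees_frac (x * y) (d + d') (f * f') (g * g').
Proof.
move=> [hf hg gp xf] [hf' hg' gp' yf].
split; [exact: ideal_powM | exact: ideal_powM | |].
  by rewrite -rees_ofM // (primeM (point_prime p)) negb_or gp.
by rewrite -!rees_ofM //; apply: stalk_fracM.
Qed.

Lemma rees_of_add d f g : ideal_pow I d f -> ideal_pow I d g ->
  rees_of d (f + g) = rees_of d f + rees_of d g.
Proof.
move=> hf hg; apply: val_inj.
rewrite -[RHS]/(val (rees_of d f) + val (rees_of d g)) !val_rees_of //.
  by rewrite scalerDl.
exact: ideal_powD.
Qed.

Lemma rees_fracD (x y : stalk p) d f g d' f' g' :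
  rees_frac x d f g -> rees_frac y d' f' g' ->
  rees_frac (x + y) (d + d') (f * g' + f' * g) (g * g').
Proof.
move=> [hf hg gp xf] [hf' hg' gp' yf].
have h1 : ideal_pow I (d + d') (f * g') by apply: ideal_powM.
have h2 : ideal_pow I (d + d') (f' * g) by rewrite addnC; apply: ideal_powM.
split; first exact: ideal_powD; first exact: ideal_powM.
  by rewrite -rees_ofM // (primeM (point_prime p)) negb_or gp.
have -> : rees_of (d + d') (f * g' + f' * g) =
    rees_of d f * rees_of d' g' + rees_of d' f' * rees_of d g.
  by rewrite !rees_ofM // [(d' + d)%N]addnC -rees_of_add.
by rewrite -rees_ofM //; apply: stalk_fracD.
Qed.

Lemma rees_of0_point : rees_of 0 1 \notin p.
Proof. by rewrite rees_of1 (prime1 (point_prime p)). Qed.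

Lemma rees_frac_const_exists f : exists x : stalk p, rees_frac x 0 f 1.
Proof. by apply: rees_frac_exists => //; apply: rees_of0_point. Qed.

(** The structure map from R to the local ring, with f viewed as the fraction f / 1 of degree 0. *)
Definition stalk_const (f : R) : stalk p := projT1 (cid (rees_frac_const_exists f)).

Lemma stalk_constE f : rees_frac (stalk_const f) 0 f 1.
Proof. by rewrite /stalk_const; case: cid. Qed.

Lemma stalk_const_zmod : zmod_morphism stalk_const.
Proof.
move=> f g; apply/eqP; rewrite eq_sym subr_eq; apply/eqP.
apply: rees_frac_eq (stalk_constE f)
  (rees_fracD (stalk_constE (f - g)) (stalk_constE g)) _.
by rewrite !mulr1 subrK.
Qed.

Lemma stalk_const_monoid : monoid_morphism stalk_const.
Proof.
split=> [|f g].
  apply: (rees_frac_eq (stalk_constE 1) (d' := 0) (f' := 1) (g' := 1)) => //.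
  split=> //; rewrite ?rees_of0_point // rees_of1; exact: stalk_frac1.
apply: rees_frac_eq (stalk_constE _)
  (rees_fracM (stalk_constE f) (stalk_constE g)) _.
by rewrite !mulr1.
Qed.

HB.instance Definition _ :=
  GRing.isZmodMorphism.Build R (stalk p) stalk_const stalk_const_zmod.
HB.instance Definition _ :=
  GRing.isMonoidMorphism.Build R (stalk p) stalk_const stalk_const_monoid.

Lemma stalk_const_inj : injective stalk_const.
Proof.
move=> f g fg; have := stalk_constE f; rewrite fg => /rees_frac_cross.
by move=> /(_ _ _ _ (stalk_constE g)); rewrite !mulr1.
Qed.

Lemma rees_frac_const (x : stalk p) d f g :
  rees_frac x d f g -> x * stalk_const g = stalk_const f.
Proof.
move=> xf; apply: rees_frac_eq (rees_fracM xf (stalk_constE g)) (stalk_constE f) _.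
by rewrite !mulr1.
Qed.

Lemma rees_frac_neq0 (x : stalk p) d f g : rees_frac x d f g -> g != 0.
Proof.
move=> [_ _ + _]; apply: contraNneq => ->; rewrite rees_of0.
exact: submod0 (prime_submod (point_prime p)).
Qed.

(** Turns an equation in the stalk into a representation as a fraction, from which membership in the
    maximal ideal can be read off. It holds because the stalk is a domain. *)
Lemma rees_frac_unique (x : stalk p) d f g :
  ideal_pow I d f -> ideal_pow I d g -> rees_of d g \notin p ->
  x * stalk_const g = stalk_const f -> rees_frac x d f g.
Proof.
move=> hf hg gp xf; have [y yf] := rees_frac_exists hf hg gp.
suff -> : x = y by [].
have /stalk_integral[/eqP|/eqP] : (x - y) * stalk_const g = 0.
- by rewrite mulrBl xf (rees_frac_const yf) subrr.
- by rewrite subr_eq0 => /eqP.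
- rewrite -(rmorph0 stalk_const) (inj_eq stalk_const_inj).
  by rewrite (negPf (rees_frac_neq0 yf)).
Qed.

End ReesStalks.

(** * The charts of a complete bipartite graph *)

Section IterPolyTheory.
Variable k : fieldType.

(** The variables of [iter_poly], the outermost one having index n - 1; an index out of range gives
    the junk value 0. *)
Fixpoint iterX (n l : nat) : iter_poly k n :=
  if n is m.+1 then
    if l == m then 'X : {poly iter_poly k m} else (iterX m l)%:P
  else 0.

Lemma iter_poly_ind n (P : iter_poly k n -> Prop) :
  (forall c, P (iterC k n c)) -> (forall l, (l < n)%N -> P (iterX n l)) ->
  (forall f g, P f -> P g -> P (f + g)) ->
  (forall f g, P f -> P g -> P (f * g)) -> forall f, P f.
Proof.
elim: n P => [|n IHn] P PC PX PD PM f; first exact: PC.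
have {}IHn c : P (c%:P).
  apply: (IHn (fun c => P c%:P)) => [{}c|l ln|u v|u v].
  - exact: PC.
  - by have := PX l (ltnW ln); rewrite /= ltn_eqF.
  - by rewrite polyCD; apply: PD.
  - by rewrite polyCM; apply: PM.
elim/poly_ind: f => [|f c Pf]; first exact: (IHn 0).
apply: PD => //; apply: PM => //.
by have := PX n (leqnn _); rewrite /= eqxx.
Qed.

Lemma iterX_neq0 n l : (l < n)%N -> iterX n l != 0.
Proof.
elim: n => // n IHn; rewrite ltnS leq_eqVlt /=.
case: eqVneq => [_ _|nl /= ln]; first by rewrite polyX_eq0.
by rewrite polyC_eq0 IHn.
Qed.

Lemma iter_poly_eval n (B : comNzRingType) (phi : {rmorphism k -> B})
    (y : nat -> B) : exists sigma : {rmorphism iter_poly k n -> B},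
  (forall c, sigma (iterC k n c) = phi c) /\
  (forall l, (l < n)%N -> sigma (iterX n l) = y l).
Proof.
elim: n => [|n [sigma [sC sX]]]; first by exists phi.
have cy : commr_rmorph sigma (y n) by move=> x; apply: mulrC.
exists (horner_morph cy); split=> [c|l]; first by rewrite /= horner_morphC.
rewrite ltnS leq_eqVlt /=; case: eqVneq => [-> _|_ /sX <-].
  exact: horner_morphX.
exact: horner_morphC.
Qed.

Lemma mpoly_rmorph_ext n (B : comNzRingType)
    (f g : {rmorphism {mpoly k[n]} -> B}) :
  (forall c, f c%:MP = g c%:MP) -> (forall l, f 'X_l = g 'X_l) -> f =1 g.
Proof.
move=> fC fX u; rewrite [u]mpolyE !raddf_sum; apply: eq_bigr => m _ /=.
rewrite -mul_mpolyC !rmorphM /= fC mpolyXE_id !rmorph_prod /=.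
by congr (_ * _); apply: eq_bigr => l _; rewrite !rmorphXn /= fX.
Qed.

End IterPolyTheory.

Lemma mpolyX_neq0 (R : nzRingType) n (l : 'I_n) : 'X_l != 0 :> {mpoly R[n]}.
Proof. by rewrite -msize_poly_eq0 msizeX. Qed.

Lemma ideal_pow1 (R : idomainType) (I : R -> Prop) x : I x -> ideal_pow I 1 x.
Proof. by move=> Ix; apply: span_in; exists x, 1; rewrite mulr1. Qed.

Lemma ideal_powX (R : idomainType) (I : R -> Prop) x d :
  I x -> ideal_pow I d (x ^+ d).
Proof.
move=> Ix; elim: d => // d IHd; rewrite exprS -add1n.
by apply: ideal_powM => //; apply: ideal_pow1.
Qed.

Section ReesStalkDimension.
Variables (k : fieldType) (n : nat) (I : {mpoly k[n]} -> Prop).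
Variable p : proj_point (rees_grading I).

(** By [indep_chain] there are r + e elements independent modulo P 0, hence independent in the
    stalk, which lies between k[x_1, .., x_n] and its fraction field. *)
Lemma stalk_dim e r (P : nat -> {pred stalk p}) : prime_chain e P ->
  indep (stalk_const p \o @mpolyC n k : {rmorphism k -> stalk p}) r (P e) ->
  (r + e <= n)%N.
Proof.
move=> hP /(indep_chain hP)[zeta [zC zI]].
apply: (indep_bound _ (@stalk_const_inj _ _ p) (@stalk_integral _ _ p) zC).
  move=> y; have [d [f [g yf]]] := rees_fracP y; exists f, g.
  by split; [apply: rees_frac_neq0 yf | apply: rees_frac_const yf].
by move=> F F0; apply: zI; rewrite F0 submod0 //; apply/prime_submod/hP.1.
Qed.

End ReesStalkDimension.

Section EdgeIdeals.
Variables (k : closedFieldType) (n : nat) (e : rel 'I_n).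
Local Notation I := (@edge_ideal n k e).

Lemma edge_mem i j : e i j -> I ('X_i * 'X_j).
Proof. by move=> eij; apply: span_in; exists i, j. Qed.

(** The elements x_i x_j t for the edges ij generate the irrelevant ideal, so p misses one of
    them. *)
Lemma exists_chart (p : proj_point (rees_grading I)) :
  exists i j, e i j /\ rees_of I 1 ('X_i * 'X_j) \notin p.
Proof.
have pS := prime_submod (point_prime p).
apply: contrapT => hn; have hp i j : e i j -> rees_of I 1 ('X_i * 'X_j) \in p.
  by move=> eij; apply: contraT => h; case: hn; exists i, j.
have hI x : I x -> rees_of I 1 x \in p.
  move=> Ix; suff [] : ideal_pow I 1 x /\ rees_of I 1 x \in p by [].
  apply: (span_ind (P := fun x => ideal_pow I 1 x /\ rees_of I 1 x \in p)) Ix =>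
    [|u v [hu up] [hv vp]|c _ [i [j [eij ->]]]].
  - by rewrite rees_of0 submod0 //; split=> //; apply: ideal_pow0.
  - by rewrite rees_of_add // submodD //; split=> //; apply: ideal_powD.
  - have hij := ideal_pow1 (edge_mem eij).
    split; first exact: ideal_powMl.
    by rewrite -[1%N]add0n -rees_ofM // submodMl // hp.
have hd d f : ideal_pow I d.+1 f -> rees_of I d.+1 f \in p.
  move=> If; suff [] : ideal_pow I d.+1 f /\ rees_of I d.+1 f \in p by [].
  apply: (span_ind (P := fun f => ideal_pow I d.+1 f /\
    rees_of I d.+1 f \in p)) If => [|u v [hu up] [hv vp]|c _ [x [y [Ix Iy ->]]]].
  - by rewrite rees_of0 submod0 //; split=> //; apply: ideal_pow0.
  - by rewrite rees_of_add // submodD //; split=> //; apply: ideal_powD.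
  - have hx := ideal_pow1 Ix; have hcy := ideal_powMl c Iy.
    rewrite mulrCA -[d.+1]add1n; split; first exact: ideal_powM.
    by rewrite -rees_ofM // submodMr // hI.
have [s s0 /negP[]] := point_relevant p.
have [N ->] := component_sum (rees_grading I) s.
apply: submod_sum => // -[[|d] dN] _ /=.
  by rewrite [rees_component _ _]s0 submod0.
have hs : homogeneous (rees_grading I) d.+1 (rees_component d.+1 s).
  exact: etrans (component_id (rees_grading I) _ _ _) (ifT _ _ (eqxx _)).
by rewrite (rees_of_coef hs); apply/hd/rees_coef.
Qed.

Section Chart.
Variables (V1 V2 : {set 'I_n}) (a b : 'I_n).
Hypotheses (V12 : [disjoint V1 & V2]) (aV1 : a \in V1) (bV2 : b \in V2).
Hypothesis e_complete : forall i j, i \in V1 -> j \in V2 -> e i j.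
Hypothesis e_bipartite : forall i j, e i j ->
  (i \in V1) && (j \in V2) || (i \in V2) && (j \in V1).
Variable p : proj_point (rees_grading I).
Let ab : {mpoly k[n]} := 'X_a * 'X_b.
Hypothesis ab_p : rees_of I 1 ab \notin p.

Local Notation iota := (stalk_const p).
Let Y (l : 'I_n) : iter_poly k n := iterX k n l.

(* The chart where x_a x_b t is invertible is the affine space with coordinates
   x_l / x_a (l in V1 other than a), x_l / x_b (l in V2 other than b) and x_l
   (all other l); x_l is the product of its coordinate and of [chart_unit]. *)
Let chart_unit (l : 'I_n) : option 'I_n :=
  if l \in V1 :\ a then Some a else if l \in V2 :\ b then Some b else None.

(** The projection from the chart to affine space, on coordinate rings. *)
Let rho : {rmorphism {mpoly k[n]} -> iter_poly k n} :=
  mmap (iterC k n) (fun l => Y l * oapp Y 1 (chart_unit l)).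

Let ab_I : I ab. Proof. exact/edge_mem/e_complete. Qed.

Let chart_unit_ab : (chart_unit a = None) * (chart_unit b = None).
Proof.
have nV2 c : c \in V1 -> c \in V2 = false.
  by move=> cV1; apply: (disjointFr V12).
rewrite /chart_unit !inE !eqxx /= nV2 // andbF; split=> //.
by rewrite (disjointFl V12) // andbF.
Qed.

Let rhoC c : rho c%:MP = iterC k n c. Proof. exact: mmapC. Qed.
Let rhoX l : rho 'X_l = Y l * oapp Y 1 (chart_unit l).
Proof. by rewrite /rho /= mmapX mmap1U. Qed.

Let rho_unit l : rho (oapp (fun c => 'X_c) 1 (chart_unit l)) =
  oapp Y 1 (chart_unit l).
Proof.
rewrite {2}/chart_unit /chart_unit; case: ifP => _.
  by rewrite /= rhoX chart_unit_ab mulr1.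
by case: ifP => _; rewrite /= ?rmorph1 // rhoX chart_unit_ab mulr1.
Qed.

Let rho_ab : rho ab = Y a * Y b.
Proof. by rewrite rmorphM !rhoX !chart_unit_ab /= !mulr1. Qed.

Let ab_neq0 : ab != 0.
Proof. by rewrite mulf_neq0 // mpolyX_neq0. Qed.

(** The ideal becomes principal on the chart: the end of an edge in V1 contributes a factor Y a, the
    end in V2 a factor Y b. *)
Let rho_dvd d F : ideal_pow I d F -> exists g, rho F = (Y a * Y b) ^+ d * g.
Proof.
have V1_dvd l : l \in V1 -> exists g, rho 'X_l = Y a * g.
  move=> lV1; have [->|la] := eqVneq l a.
    by exists 1; rewrite rhoX chart_unit_ab mulr1.
  by exists (Y l); rewrite rhoX /chart_unit !inE la lV1 mulrC.
have V2_dvd l : l \in V2 -> exists g, rho 'X_l = Y b * g.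
  move=> lV2; have [->|lb] := eqVneq l b.
    by exists 1; rewrite rhoX chart_unit_ab mulr1.
  exists (Y l); rewrite rhoX /chart_unit !inE lb lV2 mulrC.
  by rewrite (disjointFl V12) // andbF.
have I_dvd x : I x -> exists g, rho x = Y a * Y b * g.
  apply: (span_ind (P := fun x => exists g, rho x = Y a * Y b * g)) =>
    [|u v [g ug] [h vh]|c _ [i [j [eij ->]]]].
  - by exists 0; rewrite rmorph0 mulr0.
  - by exists (g + h); rewrite rmorphD ug vh mulrDr.
  - case/orP: (e_bipartite eij) => /andP[/= iV jV].
      have [g ig] := V1_dvd _ iV; have [h jh] := V2_dvd _ jV.
      by exists (rho c * g * h); rewrite !rmorphM ig jh; ring.
    have [g ig] := V2_dvd _ iV; have [h jh] := V1_dvd _ jV.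
    by exists (rho c * g * h); rewrite !rmorphM ig jh; ring.
elim: d F => [|d IHd] F; first by exists (rho F); rewrite mul1r.
apply: (span_ind (P := fun x => exists g, rho x = (Y a * Y b) ^+ d.+1 * g)) =>
  [|u v [g ug] [h vh]|c _ [x [y [/I_dvd[g xg] /IHd[h yh] ->]]]].
- by exists 0; rewrite rmorph0 mulr0.
- by exists (g + h); rewrite rmorphD ug vh mulrDr.
- by exists (rho c * g * h); rewrite !rmorphM xg yh exprS; ring.
Qed.

Let iotaK x y (z : {mpoly k[n]}) : z != 0 -> x * iota z = y * iota z -> x = y.
Proof.
move=> z0 /eqP; rewrite -subr_eq0 -mulrBl => /eqP /stalk_integral[].
  by move/eqP; rewrite subr_eq0 => /eqP.
by rewrite -(rmorph0 iota) => /stalk_const_inj z0'; rewrite z0' eqxx in z0.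
Qed.

(** The stalk is a localization of the polynomial ring of the chart, through the map [sigma] sending
    each coordinate to the corresponding quotient in the stalk. *)
Lemma regular_chart : regular_local_ring (stalk p).
Proof.
have abd_p d : rees_of I d (ab ^+ d) \notin p.
  elim: d => [|d IHd]; first by rewrite rees_of0_point.
  rewrite exprS -add1n -rees_ofM ?(primeM (point_prime p)) ?negb_or ?ab_p //.
    exact: ideal_pow1.
  exact: ideal_powX.
(* For l in V1, x_l / x_a is x_l x_b / (x_a x_b), where lb is an edge by completeness; similarly x_l
   / x_b for l in V2. *)
have /choice[y hy] (l : 'I_n) : exists y : stalk p,
    y * iota (oapp (fun c => 'X_c) 1 (chart_unit l)) = iota 'X_l.
  rewrite /chart_unit; case: ifP => [|_]; last case: ifP => [|_].
  - rewrite !inE => /andP[_ lV1].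
    have lb : I ('X_l * 'X_b) by apply/edge_mem/e_complete.
    have [y /rees_frac_const yE] :=
      rees_frac_exists (ideal_pow1 lb) (ideal_pow1 ab_I) ab_p.
    exists y; apply: (@iotaK _ _ 'X_b); first by rewrite mpolyX_neq0.
    by rewrite -mulrA -!rmorphM.
  - rewrite !inE => /andP[_ lV2].
    have al : I ('X_a * 'X_l) by apply/edge_mem/e_complete.
    have [y /rees_frac_const yE] :=
      rees_frac_exists (ideal_pow1 al) (ideal_pow1 ab_I) ab_p.
    exists y; apply: (@iotaK _ _ 'X_a); first by rewrite mpolyX_neq0.
    by rewrite -mulrA -!rmorphM /= ['X_b * _]mulrC ['X_l * _]mulrC.
  - by exists (iota 'X_l); rewrite rmorph1 mulr1.
have [sigma [sC sX]] := iter_poly_eval n (iota \o @mpolyC n k)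
  (fun l => if insub l is Some i then y i else 0).
have {}sX l : sigma (Y l) = y l by rewrite sX // valK.
have sab : sigma (Y a * Y b) = iota ab.
  by rewrite [LHS]rmorphM !sX [RHS]rmorphM /= -!hy !chart_unit_ab /= rmorph1 !mulr1.
have srho F : sigma (rho F) = iota F.
  apply: (@mpoly_rmorph_ext k n _ (sigma \o rho) iota) => [c|l] /=.
    by rewrite rhoC sC.
  rewrite rhoX rmorphM sX -hy; congr (_ * _).
  case E: (chart_unit l) => [c|] /=; last by rewrite !rmorph1.
  have : chart_unit c = None.
    move: E; rewrite {1}/chart_unit; case: ifP => [_ [<-]|_].
      by rewrite chart_unit_ab.
    by case: ifP => // _ [<-]; rewrite chart_unit_ab.
  by move=> cN; rewrite sX -hy cN /= rmorph1 mulr1.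
have Y0 : Y a * Y b != 0 by rewrite mulf_neq0 // iterX_neq0.
(* A power of x_a x_b clears the denominators of f. If [sigma] kills f, then F = 0 and hence f = 0,
   so [sigma] is injective. *)
have lift f : exists N F, sigma f * iota (ab ^+ N) = iota F /\
    rho F = (Y a * Y b) ^+ N * f.
  elim/iter_poly_ind: f => [c|l ln|f g|f g].
  - by exists 0%N, c%:MP; rewrite rhoC sC rmorph1 mulr1 mul1r.
  - have -> : iterX k n l = Y (Ordinal ln) by [].
    have [co coE] : exists co,
        co * oapp (fun c => 'X_c) 1 (chart_unit (Ordinal ln)) = ab.
      rewrite /chart_unit; case: ifP => _; first by exists 'X_b; rewrite mulrC.
      by case: ifP => _; [exists 'X_a | exists ab; rewrite mulr1].
    exists 1%N, ('X_(Ordinal ln) * co); rewrite !expr1; split.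
      by rewrite sX -coE !rmorphM /= -hy; ring.
    by rewrite -rho_ab -coE !rmorphM rhoX rho_unit; ring.
  - move=> [N [F [sF rF]]] [M [H [sH rH]]].
    exists (N + M)%N, (F * ab ^+ M + H * ab ^+ N); split.
      by rewrite exprD !rmorphD !rmorphM /= -sF -sH; ring.
    by rewrite rmorphD !rmorphM !rmorphXn /= rho_ab rF rH exprD; ring.
  - move=> [N [F [sF rF]]] [M [H [sH rH]]].
    exists (N + M)%N, (F * H); split.
      by rewrite exprD !rmorphM /= -sF -sH; ring.
    by rewrite !rmorphM rF rH exprD; ring.
apply: (@regular_localization k n _ (@stalk_max _ _ p) sigma).
- exact: stalk_max_prime.
- exact: stalk_units.
- move=> f g /eqP; rewrite -subr_eq0 -rmorphB => /eqP fg; apply/eqP.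
  have [N [F [sF rF]]] := lift (f - g); rewrite -subr_eq0.
  have F0 : F = 0 by apply: (@stalk_const_inj _ _ p); rewrite -sF fg mul0r rmorph0.
  move: rF; rewrite F0 rmorph0 => /esym/eqP.
  by rewrite mulf_eq0 expf_eq0 (negPf Y0) andbF.
(* Both f and g lie in I^d, so on the chart they are divisible by (x_a x_b)^d, and x is the ratio of
   the quotients f' and g'. *)
- move=> x; have [d [f [g xf]]] := rees_fracP x.
  have [hf hg gp _] := xf.
  have [f' ff'] := rho_dvd hf; have [g' gg'] := rho_dvd hg.
  have {}ff' : sigma f' * iota (ab ^+ d) = iota f.
    by rewrite -(srho f) ff' rmorphM rmorphXn /= sab rmorphXn mulrC.
  have {}gg' : sigma g' * iota (ab ^+ d) = iota g.
    by rewrite -(srho g) gg' rmorphM rmorphXn /= sab rmorphXn mulrC.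
  exists f', g'; split.
    (* The image of g' is g / (x_a x_b)^d, outside the maximal ideal because g t^d is outside p. *)
    have [_ _ _ g'f] : rees_frac (sigma g') d g (ab ^+ d).
      by apply: rees_frac_unique => //; apply: ideal_powX.
    by rewrite (stalk_maxE g'f).
  apply: (@iotaK _ _ (ab ^+ d)); first by rewrite expf_neq0.
  by rewrite -mulrA gg' ff' (rees_frac_const xf).
- move=> d r P hP [zeta [zC zI]]; apply: (stalk_dim hP).
  by exists zeta; split=> // c; rewrite zC /= sC.
Qed.

End Chart.
End EdgeIdeals.

(** * The cotangent space at the origin of a chart *)

Section Tangent.
Variables (k : fieldType) (R : idomainType) (I : R -> Prop) (N : nat).
Variable p : proj_point (rees_grading I).
Variables (v : nat -> {additive R -> k}) (D : 'I_N -> nat -> {additive R -> k}).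
Hypotheses
  (vM : forall d f d' f', ideal_pow I d f -> ideal_pow I d' f' ->
     v (d + d') (f * f') = v d f * v d' f')
  (DM : forall u d f d' f', ideal_pow I d f -> ideal_pow I d' f' ->
     D u (d + d') (f * f') = v d f * D u d' f' + D u d f * v d' f')
  (v_point : forall d f, ideal_pow I d f -> (rees_of I d f \in p) = (v d f == 0)).

(* The derivations D u induce linear forms on the cotangent space of the local
   ring at p; r collects their values at x. *)
Definition tangent (x : stalk p) (r : 'rV[k]_N) : Prop := exists d f g,
  [/\ rees_frac x d f g, v d f = 0 & r = \row_u (D u d f / v d g)].

(** Apply D u to f g' = f' g: by the Leibniz rule and v f = v f' = 0, only the derivatives of the
    numerators remain. *)
Lemma tangent_fun x r r' : tangent x r -> tangent x r' -> r = r'.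
Proof.
move=> [d [f [g [xf vf ->]]]] [d' [f' [g' [xf' vf' ->]]]].
have [hf hg gp _] := xf; have [hf' hg' gp' _] := xf'.
rewrite !v_point // in gp gp'.
apply/rowP => u; rewrite !mxE; apply/eqP; rewrite eqr_div //; apply/eqP.
have := congr1 (D u (d + d')) (rees_frac_cross xf xf').
by rewrite DM // addnC DM // vf vf' !mul0r !add0r.
Qed.

Lemma tangentD x y r r' : tangent x r -> tangent y r' ->
  tangent (x + y) (r + r').
Proof.
move=> [d [f [g [xf vf ->]]]] [d' [f' [g' [yf vf' ->]]]].
have [hf hg gp _] := xf; have [hf' hg' gp' _] := yf.
rewrite !v_point // in gp gp'.
exists (d + d')%N, (f * g' + f' * g), (g * g'); split.
- exact: rees_fracD.
- by rewrite raddfD /= vM // addnC vM // vf vf' !mul0r addr0.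
- apply/rowP => u; rewrite !mxE raddfD /= DM // vM //.
  by rewrite [(d + d')%N]addnC DM // vf vf'; field; rewrite gp gp'.
Qed.

Lemma tangentM c x r : tangent x r -> exists z, tangent (c * x) (z *: r).
Proof.
move=> [d [f [g [xf vf ->]]]]; have [d' [f' [g' cf]]] := rees_fracP c.
have [hf hg gp _] := xf; have [hf' hg' gp' _] := cf.
rewrite !v_point // in gp gp'.
(* The scalar is the value of c at the point. *)
exists (v d' f' / v d' g'), (d' + d)%N, (f' * f), (g' * g); split.
- exact: rees_fracM.
- by rewrite vM // vf mulr0.
- apply/rowP => u; rewrite !mxE DM // vM // vf.
  by field; rewrite gp gp'.
Qed.

Lemma tangent_max x : x \in stalk_max (p := p) -> exists r, tangent x r.
Proof.
have [d [f [g xf]]] := rees_fracP x; have [hf hg gp xfS] := xf.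
rewrite (stalk_maxE xfS) v_point // => /eqP vf.
by eexists; exists d, f, g.
Qed.

(** The rows of values on the generators span those on the whole maximal ideal. The elements dual to
    the forms D u supply all unit rows, so the span is k^N. *)
Lemma cotangent_bound (s : seq (stalk p)) :
  (forall x, x \in stalk_max (p := p) <-> span (fun y => y \in s) x) ->
  (forall u : 'I_N, exists d f g, [/\ ideal_pow I d f, ideal_pow I d g,
     v d f = 0, v d g = 1 & forall w, D w d f = (u == w)%:R]) ->
  (N <= size s)%N.
Proof.
move=> hs hD.
have /choice[t ht] (i : 'I_(size s)) : exists r, tangent s`_i r.
  by apply/tangent_max/hs/span_in/mem_nth.
pose M := \matrix_i t i.
have hM x : x \in stalk_max (p := p) -> exists r, tangent x r /\ (r <= M)%MS.
  move/hs; apply: (span_ind (P := fun x => exists r, tangent x r /\ (r <= M)%MS)).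
  - exists 0; split; last exact: sub0mx.
    exists 0%N, 0, 1; split; last by apply/rowP => u; rewrite !mxE raddf0 mul0r.
      by have := stalk_constE p 0; rewrite rmorph0.
    exact: raddf0.
  - move=> y z [r [yr rM]] [r' [zr rM']]; exists (r + r').
    by split; [apply: tangentD | apply: addmx_sub].
  - move=> c y ys; have ys' := nth_index 0 ys.
    have yi : (index y s < size s)%N by rewrite index_mem.
    have [z hz] := tangentM c (ht (Ordinal yi)).
    exists (z *: t (Ordinal yi)); rewrite -{1}ys'; split=> //.
    by apply: scalemx_sub; rewrite -[t _](rowK t) row_sub.
have M1 : (1%:M <= M)%MS.
  apply/row_subP => u; have [d [f [g [hf hg vf vg Df]]]] := hD u.
  have gp : rees_of I d g \notin p by rewrite v_point // vg oner_eq0.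
  have [x xf] := rees_frac_exists hf hg gp; have [_ _ _ xfS] := xf.
  have [|r [xr rM]] := hM x; first by rewrite (stalk_maxE xfS) v_point // vf.
  suff -> : row u 1%:M = r by [].
  apply: tangent_fun xr; exists d, f, g; split=> //.
  by apply/rowP => w; rewrite !mxE Df vg divr1.
by have := leq_trans (mxrankS M1) (rank_leq_row M); rewrite mxrank1.
Qed.

End Tangent.

(** * Laurent monomials of the chart at the edge ab *)

Section Origin.
Variables (k : closedFieldType) (n : nat) (e : rel 'I_n).
Hypothesis He : simple_graph e.
Variables (a b : 'I_n).
Hypothesis eab : e a b.
Local Notation I := (@edge_ideal n k e).
Local Notation A d := ((U_(a) + U_(b)) *+ d)%MM.

Let ab : a != b.
Proof. by apply: contraTneq eab => ->; rewrite (He.2 b). Qed.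

(* x^m lies in I^d. *)
Fixpoint edge_mono d (m : 'X_{1..n}) : Prop :=
  if d is d'.+1 then
    exists i j m', [/\ e i j, edge_mono d' m' & m = (U_(i) + U_(j) + m')%MM]
  else True.

Lemma edge_monoD d m m' : edge_mono d m -> edge_mono d (m' + m)%MM.
Proof.
elim: d m => //= d IHd m [i [j [m'' [eij hm'' ->]]]].
exists i, j, (m' + m'')%MM; split=> //; first exact: IHd.
by apply/mnmP => l; rewrite !mnmDE addnCA.
Qed.

(** The power I^d is a monomial ideal: having support in it is stable under sums and multiples. *)
Lemma msupp_edge_mono d f m : ideal_pow I d f -> m \in msupp f -> edge_mono d m.
Proof.
elim: d f m => [//|d IHd] f m hf.
pose P d (f : {mpoly k[n]}) := forall m, m \in msupp f -> edge_mono d m.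
have P0 d' : P d' 0 by move=> m'; rewrite msupp0.
have PD d' f' g' : P d' f' -> P d' g' -> P d' (f' + g').
  by move=> hf' hg' m' /msuppD_le; rewrite mem_cat => /orP[/hf'|/hg'].
have PM d' c f' : P d' f' -> P d' (c * f').
  move=> hf' m' /msuppM_le /allpairsP[[m1 m2] [_ /= hm2 ->]].
  by apply: edge_monoD; apply: hf'.
move: m; apply: (span_ind (P0 d.+1) (PD d.+1) _ hf) => c _ [x [y [Ix Iy ->]]].
apply: (PM) => m /msuppM_le /allpairsP[[m1 m2] [/= hm1 hm2 ->]].
have {}hm2 := IHd _ _ Iy hm2.
have: edge_mono 1 m1.
  move: m1 hm1; apply: (span_ind (P0 1%N) (PD 1%N) _ Ix) => {}c _ [i [j [eij ->]]].
  apply: PM => m1; rewrite -mpolyXD msuppX inE => /eqP ->.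
  by exists i, j, 0%MM; rewrite addm0.
move=> [i [j [m3 [eij _ ->]]]]; exists i, j, (m3 + m2)%MM; split=> //.
  exact: edge_monoD.
by rewrite addmA.
Qed.

(* The weight for which x_a x_b is the only edge of minimal weight. *)
Definition wt (l : 'I_n) : nat := if (l == a) || (l == b) then 1 else 2.
Definition weight (m : 'X_{1..n}) : nat := \sum_l m l * wt l.

Lemma weightD m m' : weight (m + m')%MM = (weight m + weight m')%N.
Proof. by rewrite -big_split; apply: eq_bigr => l _; rewrite mnmDE mulnDl. Qed.

Lemma weightU l : weight U_(l)%MM = wt l.
Proof.
rewrite /weight (bigD1 l) //= mnm1E eqxx mul1n big1 ?addn0 // => j jl.
by rewrite mnm1E eq_sym (negPf jl).
Qed.

Lemma weight0 : weight 0%MM = 0%N.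
Proof. by apply: big1 => l _; rewrite mnm0E. Qed.

Lemma wta : wt a = 1%N. Proof. by rewrite /wt eqxx. Qed.
Lemma wtb : wt b = 1%N. Proof. by rewrite /wt eqxx orbT. Qed.
Lemma wt_gt0 l : (0 < wt l)%N. Proof. by rewrite /wt; case: ifP. Qed.
Lemma wt1 l : wt l = 1%N -> l = a \/ l = b.
Proof. by rewrite /wt; case: eqP; case: eqP => //; [left | left | right]. Qed.

Lemma weightA d : weight (A d) = d.*2.
Proof.
elim: d => [|d IHd]; first by rewrite mulm0n weight0.
by rewrite mulmS !weightD !weightU IHd wta wtb; lia.
Qed.

Lemma mnm_case (m : 'X_{1..n}) : m = 0%MM \/ exists l m', m = (U_(l) + m')%MM.
Proof.
have [->|m0] := eqVneq m 0%MM; first by left.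
right; have [l hl] : exists l, m l != 0%N.
  apply: contrapT => h; case/eqP: m0; apply/mnmP => l; rewrite mnm0E.
  by apply/eqP; apply: contrapT => /negP hl; apply: h; exists l.
exists l, (m - U_(l))%MM; rewrite addmC submK //.
by apply/mnm_lepP => j; rewrite mnm1E; case: eqP => [<-|//]; rewrite lt0n.
Qed.

Lemma weight_eq0 m : weight m = 0%N -> m = 0%MM.
Proof.
case: (mnm_case m) => // -[l [m' ->]]; rewrite weightD weightU.
by have := wt_gt0 l; lia.
Qed.

(* The Laurent monomials x^mu / x^nu of the chart of weight 1. *)
Inductive weight1_shape : 'X_{1..n} -> 'X_{1..n} -> Prop :=
| ShapeA : weight1_shape U_(a) 0
| ShapeB : weight1_shape U_(b) 0
| ShapeNA j : e a j -> wt j = 2 -> weight1_shape U_(j) U_(b)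
| ShapeNB j : e b j -> wt j = 2 -> weight1_shape U_(j) U_(a).

(** Every edge weighs at least 2, with equality only for ab. An excess of 1 over 2d comes from a
    single extra factor x_a or x_b, or from a single edge with exactly one end in ab, whose quotient
    by x_a x_b is x_j / x_b or x_j / x_a. *)
Lemma edge_mono_weight d m : edge_mono d m ->
  [/\ (d.*2 <= weight m)%N,
      weight m = d.*2 -> m = A d &
      weight m = d.*2.+1 -> exists mu nu, weight1_shape mu nu /\
        (nu + m = A d + mu)%MM].
Proof.
elim: d m => [|d IHd] m.
  move=> _; split=> //; first by move=> /weight_eq0 ->; rewrite mulm0n.
  case: (mnm_case m) => [->|[l [m' ->]]]; first by rewrite weight0.
  rewrite weightD weightU => h.
  have hl : wt l = 1%N by have := wt_gt0 l; lia.
  have /weight_eq0 -> : weight m' = 0%N by lia.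
  rewrite addm0 mulm0n; exists U_(l)%MM, 0%MM; split=> //.
  by case: (wt1 hl) => ->; constructor.
move=> [i [j [m' [eij /IHd[h1 h2 h3] ->]]]]; rewrite !weightD !weightU.
have wi := wt_gt0 i; have wj := wt_gt0 j.
have ij : wt i = 1%N -> wt j = 1%N -> (U_(i) + U_(j) = U_(a) + U_(b))%MM.
  move=> /wt1 hi /wt1 hj; case: hi hj eij => -> [] -> //.
  - by rewrite (He.2 a).
  - by rewrite addmC.
  - by rewrite (He.2 b).
split=> [|hw|hw]; first by lia.
  by rewrite ij; try lia; rewrite h2 ?mulmS //; lia.
have [[wi1 wj1]|wij] : (wt i = 1%N /\ wt j = 1%N) \/ (wt i + wt j = 3)%N by lia.
  have [mu [nu [hs hm]]] : exists mu nu, weight1_shape mu nu /\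
    (nu + m' = A d + mu)%MM by apply: h3; lia.
  exists mu, nu; split=> //; rewrite (ij wi1 wj1) mulmS.
  by apply/mnmP => l; move/mnmP/(_ l): hm; rewrite !mnmDE; lia.
have -> : m' = A d by apply: h2; lia.
wlog wi1 : i j eij wi wj ij wij {hw} / wt i = 1%N.
  move=> H; have [/H|wi2] : wt i = 1%N \/ wt j = 1%N by lia.
    exact.
  rewrite [(U_(i) + _)%MM]addmC; apply: H => //; first by rewrite (He.1 j i).
    by move=> *; rewrite addmC; apply: ij.
  by rewrite addnC.
have wj2 : wt j = 2 by lia.
rewrite mulmS; case: (wt1 wi1) eij => -> eij.
  exists U_(j)%MM, U_(b)%MM; split; first by apply: ShapeNA.
  by apply/mnmP => l; rewrite !mnmDE; lia.
exists U_(j)%MM, U_(a)%MM; split; first by apply: ShapeNB.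
by apply/mnmP => l; rewrite !mnmDE; lia.
Qed.

(* The Laurent monomial x^mu / x^nu of the chart is not a product of two
   nontrivial ones. *)
Definition indecomposable (mu nu : 'X_{1..n}) := forall d d' m m',
  edge_mono d m -> edge_mono d' m' ->
  (nu + m + m' = A (d + d') + mu)%MM ->
  m = A d /\ (nu + m' = A d' + mu)%MM \/ m' = A d' /\ (nu + m = A d + mu)%MM.

(** A nontrivial Laurent monomial of the chart has weight at least 1. In weight at most 2, two
    nontrivial factors must thus both have weight 1, and the second hypothesis excludes this. *)
Lemma indecomposable_weight mu nu : (weight mu <= weight nu + 2)%N ->
  (weight mu = weight nu + 2 -> forall mu1 nu1 mu2 nu2,
    weight1_shape mu1 nu1 -> weight1_shape mu2 nu2 ->
    (nu + mu1 + mu2)%MM <> (nu1 + nu2 + mu)%MM) -> indecomposable mu nu.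
Proof.
move=> hw hs d d' m m' hm hm' E.
have [h1 h2 h3] := edge_mono_weight hm; have [h1' h2' h3'] := edge_mono_weight hm'.
have Ew : (weight nu + weight m + weight m' = (d + d').*2 + weight mu)%N.
  by rewrite -weightA -!weightD E.
have [wm|wm] := eqVneq (weight m) d.*2.
  left; split; first exact: h2.
  apply/(@addmI _ (A d))/mnmP => l; move/mnmP/(_ l): E; rewrite h2 //.
  by rewrite !mnmDE !mulmnE; lia.
have [wm'|wm'] := eqVneq (weight m') d'.*2.
  right; split; first exact: h2'.
  apply/(@addmI _ (A d'))/mnmP => l; move/mnmP/(_ l): E; rewrite (h2' wm').
  by rewrite !mnmDE !mulmnE; lia.
have [mu1 [nu1 [s1 E1]]] : exists mu nu, weight1_shape mu nu /\
  (nu + m = A d + mu)%MM by apply: h3; lia.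
have [mu2 [nu2 [s2 E2]]] : exists mu nu, weight1_shape mu nu /\
  (nu + m' = A d' + mu)%MM by apply: h3'; lia.
case: (hs _ _ _ _ _ s1 s2); first by lia.
apply/mnmP => l; move/mnmP/(_ l): E; move/mnmP/(_ l): E1; move/mnmP/(_ l): E2.
by rewrite !mnmDE !mulmnE; lia.
Qed.


Section Coefficient.
Variables (mu nu : 'X_{1..n}) (d : nat).

(* The coefficient of x^mu / x^nu in f / (x_a x_b)^d. *)
Definition chart_coef (f : {mpoly k[n]}) : k := ('X_[nu] * f)@_(A d + mu)%MM.

Lemma chart_coef_zmod : zmod_morphism chart_coef.
Proof. by move=> f g; rewrite /chart_coef mulrBr mcoeffB. Qed.

HB.instance Definition _ :=
  GRing.isZmodMorphism.Build {mpoly k[n]} k chart_coef chart_coef_zmod.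

Lemma chart_coefX c m :
  chart_coef (c *: 'X_[m]) = c * (nu + m == A d + mu)%MM%:R.
Proof. by rewrite /chart_coef -scalerAr mcoeffZ -mpolyXD mcoeffX. Qed.

Lemma chart_coefE f : chart_coef f =
  \sum_(m <- msupp f) f@_m * (nu + m == A d + mu)%MM%:R.
Proof.
rewrite {1}[f]mpolyE raddf_sum; apply: eq_bigr => m _; exact: chart_coefX.
Qed.

End Coefficient.

Local Notation v := (chart_coef 0 0).

Lemma indecomposable0 : indecomposable 0 0.
Proof. by apply: indecomposable_weight; rewrite weight0. Qed.

Lemma chart_coef_mul mu nu d f d' g :
  chart_coef mu nu (d + d') (f * g) = \sum_(m <- msupp f) \sum_(m' <- msupp g)
    f@_m * g@_m' * (nu + m + m' == A (d + d') + mu)%MM%:R.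
Proof.
rewrite [f in LHS]mpolyE [g in LHS]mpolyE big_distrl raddf_sum.
apply: eq_bigr => m _ /=; rewrite mulr_sumr raddf_sum; apply: eq_bigr => m' _ /=.
by rewrite -scalerAl -scalerAr scalerA -mpolyXD chart_coefX addmA.
Qed.

(** Since 1 is indecomposable, only the two constant terms contribute to the constant term of a
    product. *)
Lemma chart_coef0M d f d' g : ideal_pow I d f -> ideal_pow I d' g ->
  v (d + d') (f * g) = v d f * v d' g.
Proof.
move=> hf hg; rewrite chart_coef_mul !chart_coefE big_distrl.
apply: eq_big_seq => m hm /=; rewrite mulr_sumr; apply: eq_big_seq => m' hm'.
rewrite mulrACA -natrM mulnb; congr (_ * (nat_of_bool _)%:R).
rewrite !add0m !addm0; apply/eqP/andP => [E|[/eqP -> /eqP ->]]; last first.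
  by apply/mnmP => l; rewrite !mnmDE !mulmnE; lia.
have := indecomposable0 (msupp_edge_mono hf hm) (msupp_edge_mono hg hm').
by rewrite !add0m !addm0 => /(_ E) [] [-> ->].
Qed.

(** An indecomposable monomial arises in a product only as itself times 1, in either order; its
    coefficient is therefore a derivation at the origin. *)
Lemma chart_coefM mu nu d f d' g : indecomposable mu nu -> mu != nu ->
  ideal_pow I d f -> ideal_pow I d' g ->
  chart_coef mu nu (d + d') (f * g) =
    v d f * chart_coef mu nu d' g + chart_coef mu nu d f * v d' g.
Proof.
move=> hi munu hf hg; rewrite chart_coef_mul !chart_coefE !big_distrl -big_split.
apply: eq_big_seq => m hm /=; rewrite !mulr_sumr -big_split.
apply: eq_big_seq => m' hm' /=; rewrite !(mulrACA _ _ (g@_m')) -mulrDr.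
rewrite -!natrM -natrD !mulnb; congr (_ * _%:R); rewrite !add0m !addm0.
have := hi _ _ _ _ (msupp_edge_mono hf hm) (msupp_edge_mono hg hm').
case: (eqVneq (nu + m + m')%MM _) => [E /(_ E)|nE _].
  (* The two orders exclude each other because x^mu / x^nu is not 1. *)
  have neq d'' : (nu + A d'' == A d'' + mu)%MM = false.
    by apply: contraNF munu => /eqP; rewrite addmC => /addmI ->.
  case=> -[-> E']; rewrite eqxx E' eqxx neq ?andbF //=.
case: (eqVneq m) => /= [mA|_].
  case: (eqVneq (nu + m')%MM) => /= [E|_]; last first.
    case: (eqVneq m') => [m'A|_]; last by rewrite andbF.
    rewrite andbT; case: eqVneq => // E; case/eqP: nE.
    by rewrite m'A E; apply/mnmP => l; rewrite !mnmDE !mulmnE; lia.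
  case/eqP: nE; rewrite mA; apply/mnmP => l; move/mnmP/(_ l): E.
  by rewrite !mnmDE !mulmnE; lia.
case: (eqVneq (nu + m)%MM) => //= E; case: eqVneq => //= m'A.
by case/eqP: nE; rewrite m'A E; apply/mnmP => l; rewrite !mnmDE !mulmnE; lia.
Qed.

(* The origin of the chart, where all nontrivial Laurent monomials vanish. *)
Definition origin_pred : {pred rees I} := fun s =>
  `[< forall d, v d (val s)`_d = 0 >].

(** The evaluation of the Rees algebra at the origin, sending f t^d to v(f) t^d. It is a ring map to
    k[t] with kernel [origin_pred], which is why the latter is prime. *)
Definition origin_value (s : rees I) : {poly k} :=
  \poly_(d < size (val s)) v d (val s)`_d.

Lemma coef_origin_value s d : (origin_value s)`_d = v d (val s)`_d.
Proof.
by rewrite coef_poly; case: ltnP => // h; rewrite nth_default // raddf0.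
Qed.

Lemma origin_predE s : (s \in origin_pred) = (origin_value s == 0).
Proof.
apply/asboolP/eqP => [h|h d]; last by rewrite -coef_origin_value h coef0.
by apply/polyP => d; rewrite coef_origin_value h coef0.
Qed.

Lemma origin_valueD s t : origin_value (s + t) = origin_value s + origin_value t.
Proof.
apply/polyP => d; rewrite coefD !coef_origin_value.
by rewrite -[val (s + t)]/(val s + val t) coefD raddfD.
Qed.

Lemma origin_valueM s t : origin_value (s * t) = origin_value s * origin_value t.
Proof.
apply/polyP => d; rewrite coefM !coef_origin_value.
rewrite -[val (s * t)]/(val s * val t) coefM raddf_sum; apply: eq_bigr => i _.
rewrite !coef_origin_value -chart_coef0M; try exact: rees_coef.
by rewrite subnKC // -ltnS.
Qed.

Lemma origin_value1 : origin_value 1 = 1.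
Proof.
apply/polyP => d; rewrite coef_origin_value -[val 1]/(1 : {poly _}) !coef1.
case: d => [|d]; last by rewrite raddf0.
by rewrite /chart_coef mulr1 addm0 mulm0n mcoeffX eqxx.
Qed.

Lemma origin_prime : prime_ideal origin_pred.
Proof.
have z0 : origin_value 0 = 0.
  apply/polyP => d; rewrite coef_origin_value coef0 -[val 0]/(0 : {poly _}).
  by rewrite coef0 raddf0.
split; [split|].
- by rewrite origin_predE z0.
- by rewrite origin_predE origin_value1 oner_eq0.
- move=> c s t; rewrite !origin_predE origin_valueD origin_valueM.
  by move=> /eqP -> /eqP ->; rewrite mulr0 addr0.
- by move=> s t; rewrite !origin_predE origin_valueM mulf_eq0.
Qed.

Lemma origin_homogeneous d s : s \in origin_pred ->
  component (rees_grading I) d s \in origin_pred.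
Proof.
move=> /asboolP h; apply/asboolP => i.
rewrite -[val (component _ _ _)]/((val s)`_d *: 'X^d) coefZ coefXn.
by case: eqP => [->|_]; rewrite ?mulr1 ?mulr0 ?h ?raddf0.
Qed.

Lemma rees_of_origin d f : ideal_pow I d f ->
  (rees_of I d f \in origin_pred) = (v d f == 0).
Proof.
move=> hf; apply/asboolP/eqP => [/(_ d)|h i]; rewrite val_rees_of //.
  by rewrite coefZ coefXn eqxx mulr1.
by rewrite coefZ coefXn; case: eqP => [->|_]; rewrite ?mulr1 ?mulr0 ?h ?raddf0.
Qed.

Lemma v_ab d : v d ('X_[A d]) = 1.
Proof. by rewrite -[X in v d X]scale1r chart_coefX add0m addm0 eqxx mulr1. Qed.

Lemma ideal_ab d : ideal_pow I d 'X_[A d].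
Proof. by rewrite -mpolyXn mpolyXD; apply: ideal_powX; apply: edge_mem. Qed.

Lemma origin_relevant :
  exists2 s, component (rees_grading I) 0 s = 0 & s \notin origin_pred.
Proof.
exists (rees_of I 1 'X_[A 1]); last first.
  by rewrite rees_of_origin ?v_ab ?oner_eq0 //; apply: ideal_ab.
apply: val_inj; rewrite -[LHS]/((val (rees_of I 1 'X_[A 1]))`_0 *: 'X^0).
by rewrite val_rees_of ?coefZ ?coefXn ?mulr0 ?scale0r //; apply: ideal_ab.
Qed.

Definition origin : proj_point (rees_grading I) :=
  ProjPoint origin_prime origin_homogeneous origin_relevant.

(* Indecomposable Laurent monomials of the chart are linearly independent in
   the cotangent space of the origin. *)
Lemma indecomposable_bound (T : finType) (mu nu : T -> 'X_{1..n}) :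
  tame_graph k e ->
  (forall u, indecomposable (mu u) (nu u)) -> (forall u, mu u != nu u) ->
  (forall u, exists d m,
    ideal_pow I d 'X_[m] /\ (nu u + m = A d + mu u)%MM) ->
  (forall u w, (nu w + mu u = nu u + mu w)%MM -> u = w) -> (#|T| <= n)%N.
Proof.
move=> tame_e hi munu hm hinj.
have [_ [mx [d [[_ loc] [[P hP] _] [s hs]]]]] := tame_e origin.
(* Regularity provides d generators of the maximal ideal, d being the dimension. The case r = 0 of
   [stalk_dim] gives d <= n, and [cotangent_bound] gives #|T| <= d. *)
apply: (@leq_trans d); last first.
  have := stalk_dim hP (indep0 _ (hP.1 _ (leqnn d))).
  by rewrite add0n.
have mxE := loc _ (stalk_local origin).1.
rewrite -(size_tuple s).
pose D (i : 'I_#|T|) d' : {additive {mpoly k[n]} -> k} :=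
  chart_coef (mu (enum_val i)) (nu (enum_val i)) d'.
apply: (@cotangent_bound k _ I #|T| origin (fun d => v d) D).
- by move=> *; apply: chart_coef0M.
- by move=> *; apply: chart_coefM.
- by move=> *; apply: rees_of_origin.
- by move=> x; rewrite mxE.
- move=> i; have [d' [m [mI mE]]] := hm (enum_val i).
  exists d', 'X_[m], 'X_[A d']; split=> //; [exact: ideal_ab| |exact: v_ab|].
    rewrite /= -[X in v d' X]scale1r chart_coefX add0m addm0 mul1r.
    case: eqVneq => // mA; case/eqP: (munu (enum_val i)).
    by apply/mnmP => l; move/mnmP/(_ l): mE; rewrite mA !mnmDE; lia.
  move=> w; rewrite /= -[X in chart_coef _ _ _ X]scale1r chart_coefX mul1r.
  congr (nat_of_bool _)%:R; apply/eqP/eqP => [E|<-//].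
  apply/enum_val_inj/hinj/mnmP => l.
  move/mnmP/(_ l): E; move/mnmP/(_ l): mE; rewrite !mnmDE => E1 E2.
  by apply/(@addIn (m l)); rewrite addnAC E2 [RHS]addnAC E1 addnAC.
Qed.

(* x_l / x^(coord_den l) for l in [n] are n of the indecomposables. *)
Definition coord_den (l : 'I_n) : 'X_{1..n} :=
  if wt l == 1%N then 0%MM else
  if e a l then U_(b)%MM else if e b l then U_(a)%MM else 0%MM.

Lemma wt2P l : wt l = 2 -> l != a /\ l != b.
Proof. by rewrite /wt; case: eqP => //; case: eqP. Qed.

Lemma wt2_neighbour l : e a l -> e b l -> wt l = 2.
Proof.
rewrite /wt; case: eqVneq => [->|_]; first by rewrite (He.2 a).
by case: eqVneq => [->|//] _; rewrite (He.2 b).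
Qed.

Lemma wt_case l : wt l = 1%N \/ wt l = 2.
Proof. by rewrite /wt; case: ifP; [left | right]. Qed.

Lemma coord_denE l : coord_den l = 0%MM \/
  wt l = 2 /\ (coord_den l = U_(a) \/ coord_den l = U_(b))%MM.
Proof.
rewrite /coord_den; case: eqP; first by left.
have [->//|w2 _] := wt_case l.
by case: ifP => _; [right; auto | case: ifP => _; [right | left]; auto].
Qed.

Lemma coord_den_eq0 l j : (j = l \/ wt j = 2) -> coord_den l j = 0%N.
Proof.
have [->|[wl]] := coord_denE l; first by rewrite mnm0E.
have [la lb] := wt2P wl.
by move=> + [->|/wt2P[ja jb]]; case=> ->; rewrite mnm1E eq_sym; apply/eqP;
  rewrite eqb0.
Qed.

Lemma shape_den mu nu l : weight1_shape mu nu -> wt l = 2 -> nu l = 0%N.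
Proof.
by case=> [||j _ _|j _ _] /wt2P[la lb]; rewrite ?mnm0E // mnm1E eq_sym;
  apply/eqP; rewrite eqb0.
Qed.

Lemma shape_num mu nu l : weight1_shape mu nu -> wt l = 2 -> mu l <> 0%N ->
  mu = U_(l)%MM /\ (e a l /\ nu = U_(b)%MM \/ e b l /\ nu = U_(a)%MM).
Proof.
case=> [||j ej _|j ej _] /wt2P[la lb]; rewrite mnm1E.
- by rewrite eq_sym (negPf la).
- by rewrite eq_sym (negPf lb).
- by case: eqP => [<-|//] _; split=> //; left.
- by case: eqP => [<-|//] _; split=> //; right.
Qed.

(** The weight is 1 unless the denominator is trivial and x_l has weight 2. In that case l is
    adjacent to neither a nor b, so x_l occurs in no numerator of weight 1. *)
Lemma coord_indecomposable l : indecomposable U_(l) (coord_den l).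
Proof.
apply: indecomposable_weight; rewrite weightU.
  by have [->|->] := wt_case l; rewrite addn2.
have [dl|[wl [dl|dl]]] := coord_denE l; rewrite dl ?weight0 ?weightU.
- move=> wl mu1 nu1 mu2 nu2 s1 s2 /mnmP/(_ l).
  have wl2 : wt l = 2 by rewrite wl.
  rewrite !mnmDE mnm0E mnm1E eqxx (shape_den s1) // (shape_den s2) //.
  have nb mu nu : weight1_shape mu nu -> mu l = 0%N.
    move=> s; apply: contrapT => /(shape_num s wl2)[_ h].
    move: dl; rewrite /coord_den wl2 /=.
    case: h => -[-> _]; first by move/mnmP/(_ b); rewrite mnm1E mnm0E eqxx.
    by case: ifP => _ /mnmP; [move/(_ b)|move/(_ a)]; rewrite mnm1E mnm0E eqxx.
  by rewrite (nb _ _ s1) (nb _ _ s2).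
- by rewrite wta wl.
- by rewrite wtb wl.
Qed.

(** Together with the n coordinates, one further indecomposable would give n + 1 independent
    cotangent vectors. *)
Lemma singular_origin mu nu : tame_graph k e ->
  indecomposable mu nu -> mu != nu ->
  (exists d m, ideal_pow I d 'X_[m] /\ (nu + m = A d + mu)%MM) ->
  (forall l, (coord_den l + mu <> nu + U_(l))%MM) -> False.
Proof.
move=> tame_e hi munu hm hl.
suff : (#|{: option 'I_n}| <= n)%N by rewrite card_option card_ord ltnn.
pose mus u := if u is Some l then U_(l)%MM else mu.
pose nus u := if u is Some l then coord_den l else nu.
apply: (@indecomposable_bound _ mus nus) => // [[l|]|[l|]|[l|]|[l|] [l'|]] //=.
- exact: coord_indecomposable.
- apply/eqP => /mnmP/(_ l); rewrite mnm1E eqxx coord_den_eq0 //; by left.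
- rewrite /coord_den; case: ifP => _.
    by exists 0%N, U_(l)%MM; split=> //; rewrite mulm0n.
  case: ifP => [eal|_]; last case: ifP => [ebl|_].
  + exists 1%N, (U_(a) + U_(l))%MM; split.
      by rewrite mpolyXD; apply/ideal_pow1/edge_mem.
    by apply/mnmP => j; rewrite !mnmDE; lia.
  + exists 1%N, (U_(b) + U_(l))%MM; split.
      by rewrite mpolyXD; apply/ideal_pow1/edge_mem.
    by apply/mnmP => j; rewrite !mnmDE; lia.
  + by exists 0%N, U_(l)%MM; split=> //; rewrite mulm0n.
- move=> /mnmP/(_ l'); rewrite !mnmDE !mnm1E eqxx coord_den_eq0; last by left.
  by case: eqVneq => [->//|_]; rewrite addn1.
- by move=> h; case: (hl l); rewrite -h.
- by move=> h; case: (hl l').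
Qed.

(** The coordinate with numerator x_j is x_j / x_b; the edge bj provides x_j / x_a as an additional
    monomial of weight 1. *)
Lemma tame_triangle_free j : tame_graph k e -> e a j -> e b j -> False.
Proof.
move=> tame_e eaj ebj; have wj := wt2_neighbour eaj ebj; have [ja jb] := wt2P wj.
apply: (@singular_origin U_(j) U_(a)) => //.
- by apply: indecomposable_weight; rewrite !weightU wj wta.
- by apply/eqP => /mnmP/(_ j); rewrite !mnm1E eqxx eq_sym (negPf ja).
- exists 1%N, (U_(b) + U_(j))%MM; split.
    by rewrite mpolyXD; apply/ideal_pow1/edge_mem.
  by apply/mnmP => l; rewrite !mnmDE; lia.
- move=> l h; have lj : l = j.
    move/mnmP/(_ j): h; rewrite !mnmDE coord_den_eq0; last by right.
    by rewrite !mnm1E eqxx [a == j]eq_sym (negPf ja); case: eqP.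
  move/mnmP/(_ a): h; rewrite lj /coord_den wj eaj /= !mnmDE !mnm1E eqxx.
  by rewrite [b == a]eq_sym (negPf ab) (negPf ja).
Qed.

(** The monomial x_i x_j / (x_a x_b) has weight 2. Its only possible factorizations are (x_i /
    x_b)(x_j / x_a) and (x_i / x_a)(x_j / x_b), which require the edges of a 4-cycle. *)
Lemma tame_four_cycle i j : tame_graph k e -> e i j ->
  i != a -> i != b -> j != a -> j != b ->
  (e a i /\ e b j) \/ (e b i /\ e a j).
Proof.
move=> tame_e eij ia ib ja jb; apply: contrapT => hn.
have ij : i != j by apply: contraTneq eij => ->; rewrite (He.2 j).
have wi : wt i = 2 by rewrite /wt (negPf ia) (negPf ib).
have wj : wt j = 2 by rewrite /wt (negPf ja) (negPf jb).
apply: (@singular_origin (U_(i) + U_(j)) (U_(a) + U_(b))) => //.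
- apply: indecomposable_weight; rewrite !weightD !weightU wi wj wta wtb //.
  have ba : (b == a) = false by rewrite eq_sym (negPf ab).
  have key mu1 nu1 mu2 nu2 : weight1_shape mu1 nu1 -> weight1_shape mu2 nu2 ->
      (U_(a) + U_(b) + mu1 + mu2 = nu1 + nu2 + (U_(i) + U_(j)))%MM ->
      mu1 i <> 0%N -> False.
    move=> s1 s2 h /(shape_num s1 wi)[mu1E h1].
    have [mu2E h2] : mu2 = U_(j)%MM /\
        (e a j /\ nu2 = U_(b) \/ e b j /\ nu2 = U_(a))%MM.
      apply: (shape_num s2 wj) => m2j; move/mnmP/(_ j): h.
      rewrite !mnmDE m2j mu1E (shape_den s1) // (shape_den s2) // !mnm1E.
      by rewrite eqxx (negPf ij) [a == j]eq_sym [b == j]eq_sym (negPf ja) (negPf jb).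
    have nuE l : (nu1 l + nu2 l = (a == l) + (b == l))%N.
      by move/mnmP/(_ l): h; rewrite mu1E mu2E !mnmDE !mnm1E -addnA => /addIn ->.
    case: h1 h2 => -[h1 nu1E] [] [h2 nu2E]; try by apply: hn; auto.
      by have := nuE a; rewrite nu1E nu2E !mnm1E eqxx ba.
    by have := nuE b; rewrite nu1E nu2E !mnm1E eqxx (negPf ab).
  (* The variable x_i divides one of the two numerators; by symmetry it may be taken to be the
     first. *)
  move=> _ mu1 nu1 mu2 nu2 s1 s2 h.
  have [m1i|m1i] := eqVneq (mu1 i) 0%N; last by apply: key s1 s2 h _; apply/eqP.
  apply: (key _ _ _ _ s2 s1) => [|m2i].
    by rewrite -addmA [(mu2 + _)%MM]addmC addmA h [(nu1 + _)%MM]addmC.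
  move/mnmP/(_ i): h; rewrite !mnmDE m1i m2i (shape_den s1) // (shape_den s2) //.
  by rewrite !mnm1E eqxx [a == i]eq_sym [b == i]eq_sym (negPf ia) (negPf ib).
- apply/eqP => /mnmP/(_ i); rewrite !mnmDE !mnm1E eqxx.
  by rewrite [a == i]eq_sym (negPf ia) [b == i]eq_sym (negPf ib).
- exists 1%N, (U_(i) + U_(j))%MM; split; last by rewrite mulm1n.
  by rewrite mpolyXD; apply/ideal_pow1/edge_mem.
- move=> l h.
  (* Denominators involve only x_a and x_b, so exponents at t compare numerators; t = i and t = j
     would force l = i and l = j. *)
  have h' t : wt t = 2 -> ((i == t) + (j == t) = (l == t))%N.
    move=> wt2; have [ta tb] := wt2P wt2.
    move/mnmP/(_ t): h; rewrite !mnmDE coord_den_eq0; last by right.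
    by rewrite !mnm1E [a == t]eq_sym [b == t]eq_sym (negPf ta) (negPf tb).
  move: (h' i wi) (h' j wj); rewrite !eqxx (negPf ij) [j == i]eq_sym (negPf ij).
  by case: eqP => // ->; rewrite (negPf ij).
Qed.

End Origin.

(** * Classification of the tame graphs *)

Lemma complete_bipartite_tame (k : closedFieldType) (n : nat) (e : rel 'I_n) :
  simple_graph e -> complete_bipartite_plus_isolated e -> tame_graph k e.
Proof.
move=> He [W [[V1 [V2 [WE V12 eE]]] W_isolated]] p.
have eW i j : e i j -> i \in W.
  by apply: contraLR => /W_isolated; apply.
have eW' i j : e i j -> j \in W by rewrite (He.1 i j); apply: eW.
have V1W i : i \in V1 -> i \in W by rewrite WE inE => ->.
have V2W i : i \in V2 -> i \in W by rewrite WE inE orbC => ->.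
have complete i j : i \in V1 -> j \in V2 -> e i j.
  by move=> iV1 jV2; rewrite (eE _ _ (V1W _ iV1) (V2W _ jV2)) iV1 jV2.
have bipartite i j : e i j ->
    (i \in V1) && (j \in V2) || (i \in V2) && (j \in V1).
  by move=> eij; rewrite -(eE _ _ (eW _ _ eij) (eW' _ _ eij)).
have [a [b [eab abp]]] := exists_chart p.
case/orP: (bipartite a b eab) => /andP[aV bV].
  exact: (regular_chart V12 aV bV complete bipartite abp).
rewrite mulrC in abp.
exact: (regular_chart V12 bV aV complete bipartite abp).
Qed.

Lemma tame_complete_bipartite (k : closedFieldType) (n : nat) (e : rel 'I_n) :
  simple_graph e -> tame_graph k e -> complete_bipartite_plus_isolated e.
Proof.
move=> He tame_e; have sym := He.1.
have tri a b j : e a b -> e a j -> e b j -> False.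
  by move=> eab; apply: tame_triangle_free tame_e.
have cyc a b i j : e a b -> e i j -> i != a -> i != b -> j != a -> j != b ->
    (e a i /\ e b j) \/ (e b i /\ e a j).
  by move=> eab; apply: tame_four_cycle tame_e.
have [[a [b eab]]|no_edge] := pselect (exists a b, e a b); last first.
  exists set0; split=> [|v _ w]; last
    by apply/negP => h; apply: no_edge; exists v, w.
  exists set0, set0; split; first by rewrite setU0.
    by rewrite -setI_eq0 set0I.
  by move=> u w; rewrite inE.
have eba : e b a by rewrite sym.
(* For a fixed edge ab the parts can only be the two neighbourhoods, V1 containing a and V2
   containing b. *)
pose V1 := [set x | e b x]; pose V2 := [set x | e a x].
have inV1 x : (x \in V1) = e b x by rewrite inE.
have inV2 x : (x \in V2) = e a x by rewrite inE.
have cross u w : e b u -> e a w -> e u w.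
  move=> ebu eaw; have [->//|ua] := eqVneq u a.
  have [->|wb] := eqVneq w b; first by rewrite sym.
  have uw : w != u.
    apply: contraTneq eaw => ->.
    by apply/negP => eau; case: (tri a b u).
  have eub : e u b by rewrite sym.
  have ab : a != b by apply: contraTneq eab => ->; rewrite He.2.
  have au : a != u by rewrite eq_sym.
  (* The disjoint edges ub and aw form a 4-cycle. Either uw is an edge, or bw is, giving the
     triangle abw. *)
  case: (cyc u b a w eub eaw au ab uw wb) => -[] // _ ebw.
  by case: (tri _ _ w eab).
exists (V1 :|: V2); split; last first.
  move=> v; rewrite in_setU inV1 inV2 negb_or => /andP[nbv nav] w.
  apply/negP => evw.
  have va : v != a by apply: contraNneq nbv => ->.
  have vb : v != b by apply: contraNneq nav => ->.
  have wa : w != a by apply: contraNneq nav => <-; rewrite sym.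
  have wb : w != b by apply: contraNneq nbv => <-; rewrite sym.
  (* An edge at v would be disjoint from ab, and the 4-cycle it forms with ab would make v a
     neighbour of a or b. *)
  by case: (cyc a b v w eab evw va vb wa wb) => -[h _];
    [move: nav | move: nbv]; rewrite h.
exists V1, V2; split=> //.
  apply/pred0P => x /=; rewrite inV1 inV2; apply/negP => /andP[ebx eax].
  exact: tri eab eax ebx.
move=> u w; rewrite !in_setU !inV1 !inV2 => hu hw.
apply/idP/orP => [euw|[/andP[]|/andP[eau ebw]]]; last 2 first.
- exact: cross.
- by rewrite sym; apply: cross.
have [ebu|nbu] := boolP (e b u).
  left=> /=; case/orP: hw => // ebw; case: (tri u w b euw); by rewrite sym.
rewrite (negPf nbu) /= in hu; right; rewrite hu /=.
by case/orP: hw => // eaw; case: (tri u w a euw); rewrite sym.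
Qed.

Theorem corollary3p6 (k : closedFieldType) (n : nat) (e : rel 'I_n)
  (He : simple_graph e) :
  tame_graph k e <-> complete_bipartite_plus_isolated e.
Proof.
by split; [apply: tame_complete_bipartite | apply: complete_bipartite_tame].
Qed.
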